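(* Let $\mathbb{S}=\bigl\{\{1,2\},\{2,3\},\{1,3\}\bigr\}$ with $|\mathcal{X}_1|=r$ for some $r \geq 2$, $|\mathcal{X}_2|=2$ and $|\mathcal{X}_3|=2$. There exists a universal constant $c > 0$ such that, for all sample sizes $n_{\mathbb{S}} = (n_S : S \in \mathbb{S}) \in \mathbb{N}^{\mathbb{S}}$, \[ \rho^*(n_{\mathbb{S}}) \geq c \max \biggl\{ \frac{1}{\log r} \wedge \biggl( \frac{r}{(n_{\{1,2\}} \wedge n_{\{1,3\}} ) \log r} \biggr)^{1/2},\; \frac{1}{(\min_{S \in \mathbb{S}} n_S)^{1/2}} \biggr\}. \]
   Context: Notation: $a \wedge b := \min(a,b)$; $\mathcal{X}_j$ are finite (discrete) sets, $\mathcal{X} := \mathcal{X}_1\times\mathcal{X}_2\times\mathcal{X}_3$, $\mathcal{X}_S := \prod_{j \in S}\mathcal{X}_j$, $x_S := (x_j : j \in S)$. ''Universal'' means that $c$ does not depend on $r$ or $n_{\mathbb{S}}$. $\mathcal{P}_{\mathbb{S}}$ is the set of sequences $P_{\mathbb{S}} = (P_S : S \in \mathbb{S})$ with $P_S$ a probability distribution on $\mathcal{X}_S$. $\mathcal{P}_{\mathbb{S}}^0 \subseteq \mathcal{P}_{\mathbb{S}}$ is the subset of compatible sequences: those for which there is a distribution on $\mathcal{X}$ with marginal $P_S$ on $\mathcal{X}_S$ for every $S \in \mathbb{S}$. Incompatibility index (discrete case): let $\mathcal{G}_{\mathbb{S}}^+$ be the set of sequences $f_{\mathbb{S}} = (f_S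 : S \in \mathbb{S})$ of functions $f_S : \mathcal{X}_S \to [-1,\infty)$ with $\min_{x \in \mathcal{X}} \sum_{S \in \mathbb{S}} f_S(x_S) \geq 0$. Then $R(P_{\mathbb{S}}) := \sup_{f_{\mathbb{S}} \in \mathcal{G}_{\mathbb{S}}^+} \bigl\{-\frac{1}{|\mathbb{S}|}\sum_{S \in \mathbb{S}} \sum_{x_S \in \mathcal{X}_S} f_S(x_S) P_S(\{x_S\})\bigr\} \in [0,1]$. For $\rho \geq 0$ put $\mathcal{P}_{\mathbb{S}}(\rho) := \{P_{\mathbb{S}} \in \mathcal{P}_{\mathbb{S}} : R(P_{\mathbb{S}}) \geq \rho\}$. Minimax framework: given $n_{\mathbb{S}}$, we observe independent random variables $(X_{S,i})_{S \in \mathbb{S}, i \in \{1,\ldots,n_S\}}$ with $X_{S,i} \sim P_S$, and $\mathbb{E}_{P_{\mathbb{S}}}$ denotes expectation under this model. A test is a measurable function $\psi' : \prod_{S \in \mathbb{S}} \mathcal{X}_S^{n_S} \to [0,1]$ of the data; $\Psi'_{n_{\mathbb{S}}}$ is the set of all tests. The minimax risk at separation $\rho$ is \[ \mathcal{R}(n_{\mathbb{S}},\rho) := \inf_{\psi' \in \Psi'_{n_{\mathbb{S}}}}\Bigl\{ \sup_{P_{\mathbb{S}} \in \mathcal{P}_{\mathbb{S}}^0} \mathbb{E}_{P_{\mathbb{S}}}(\psi') + \sup_{P_{\mathbb{S}} \in \mathcal{P}_{\mathbb{S}}(\rho)}\mathbb{E}_{P_{\mathbb{S}}}(1-\psi')\Bigr\}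 \] (a supremum over the empty set is $0$, so that $\mathcal{R}(n_{\mathbb{S}},\rho)=0$ for $\rho>1$), and the minimax testing radius is $\rho^*(n_{\mathbb{S}}) := \inf\{\rho \geq 0 : \mathcal{R}(n_{\mathbb{S}},\rho) \leq 1/2\}$. *)

(* Defs.v *)
From mathcomp Require Import all_boot all_order all_algebra.
From mathcomp Require Import all_classical all_reals all_analysis.

Set Implicit Arguments.
Unset Strict Implicit.
Unset Printing Implicit Defensive.

Import Order.TTheory GRing.Theory Num.Theory.

Local Open Scope classical_set_scope.
Local Open Scope ring_scope.

(* The observed patterns are SS = {{1,2}, {2,3}, {1,3}}; a sequence indexed by
   SS has three entries.  For nonempty alphabets and P in [dists] every [sup] is over a
   bounded set and every [inf] over a nonempty set of nonnegative reals; the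
   supremum over an empty class of distributions is [sup set0 = 0]. *)

Section Testing.
Variables (R : realType) (X1 X2 X3 : finType).

Definition is_dist (T : finType) (p : T -> R) : Prop :=
  (forall x, 0 <= p x) /\ \sum_x p x = 1.

(* A sequence (g_S : S in SS) of real functions g_S on X_S; used both for
   probability mass functions P_S and for the functions f_S. *)
Record family := Family {
  at12 : X1 * X2 -> R;
  at23 : X2 * X3 -> R;
  at13 : X1 * X3 -> R }.

Definition dists : set family :=
  [set P | [/\ is_dist (at12 P), is_dist (at23 P) & is_dist (at13 P)]].

Definition has_marginals (p : X1 * X2 * X3 -> R) (P : family) : Prop :=
  [/\ forall x1 x2, at12 P (x1, x2) = \sum_x3 p (x1, x2, x3),
      forall x2 x3, at23 P (x2, x3) = \sum_x1 p (x1, x2, x3) &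
      forall x1 x3, at13 P (x1, x3) = \sum_x2 p (x1, x2, x3)].

Definition compatible_dists : set family :=
  [set P | dists P /\ exists p, is_dist p /\ has_marginals p P].

Definition Gplus : set family :=
  [set f | [/\ forall u, -1 <= at12 f u,
               forall u, -1 <= at23 f u,
               forall u, -1 <= at13 f u &
               forall x1 x2 x3,
                 0 <= at12 f (x1, x2) + at23 f (x2, x3) + at13 f (x1, x3)]].

(* The factor 3 is the cardinality of SS. *)
Definition incompatibility (P : family) : R :=
  sup [set - (3%:R^-1 * (\sum_u at12 f u * at12 P u
                       + \sum_u at23 f u * at23 P u
                       + \sum_u at13 f u * at13 P u)) | f in Gplus].

Definition separated_dists (rho : R) : set family :=
  [set P | dists P /\ rho <= incompatibility P].

Variables n12 n23 n13 : nat.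

Definition sample : finType :=
  ({ffun 'I_n12 -> X1 * X2} * {ffun 'I_n23 -> X2 * X3}
     * {ffun 'I_n13 -> X1 * X3})%type.

Definition likelihood (P : family) (z : sample) : R :=
  (\prod_i at12 P (z.1.1 i)) * (\prod_i at23 P (z.1.2 i))
    * (\prod_i at13 P (z.2 i)).

Definition expectation_under (P : family) (g : sample -> R) : R :=
  \sum_z g z * likelihood P z.

(* The sample space is finite and discrete: measurability is automatic. *)
Definition tests : set (sample -> R) :=
  [set psi | forall z, 0 <= psi z <= 1].

Definition test_risk (rho : R) (psi : sample -> R) : R :=
  sup [set expectation_under P psi | P in compatible_dists]
  + sup [set expectation_under P (fun z => 1 - psi z)
        | P in separated_dists rho].

Definition minimax_risk (rho : R) : R :=
  inf [set test_risk rho psi | psi in tests].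

Definition testing_radius : R :=
  inf [set rho : R | 0 <= rho /\ minimax_risk rho <= 2^-1].

End Testing.

(* Main.v *)
Require Import Defs.
From mathcomp Require Import all_boot all_order all_algebra.
From mathcomp Require Import all_classical all_reals all_analysis.
From mathcomp Require Import zify ring lra.

Set Implicit Arguments.
Unset Strict Implicit.
Unset Printing Implicit Defensive.

Import Order.TTheory GRing.Theory Num.Theory numFieldNormedType.Exports.
Local Open Scope ring_scope.

(** A lower bound on the radius follows if, for every smaller separation, two
    priors, one on (mostly) compatible and one on (mostly) separated families,
    give mixtures of data laws that no test tells apart
    ([test_risk_ge_mixtures], [testing_radius_ge]). Lower bounds on the
    incompatibility index come from a single dual certificate
    ([dual_value_le_incompatibility]), and compatibility from an explicit joint
    law.

    Parametric rate. Tilting one of the laws [P_{12}], [P_{23}] by a relative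
    amount of order [n ^ (-1/2)] moves its marginal on [X2] away from that of
    the other one, which makes the family incompatible by that order, while the
    laws of the data remain close ([radius_ge_parametric12],
    [radius_ge_parametric23]). The sample of [P_{13}] is handled by the symmetry
    that exchanges the two binary coordinates ([testing_radius_swap]).

    Nonparametric rate. Fix [P_{13}] uniform and put
    [P_{12}(x, x2) = (1 + s(x2) eta(x)) / (2 r)] with a sign [s] and
    [sum eta = 0]. For a suitable [P_{23}] depending on one parameter, the
    family is compatible when the mean of [|eta|] is below a threshold, and is
    incompatible by a multiple of the excess when it is above it
    ([modulus_family_compatible], [modulus_family_incompatibility]). Testing
    compatibility thus contains the problem of deciding how large an average of
    absolute values is, which is hard because the absolute value is poorly
    approximated by polynomials: there are two probability measures on [-1, 1]
    with the same moments up to order [2 D + 1] and mean absolute values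
    at least [1 / (30 D)] apart ([exists_moment_matching_measures]). Drawing
    [eta = a t] from these measures, independently on pairs of points of [X1]
    with opposite signs within a pair (this makes [sum eta = 0] exact), the
    samples can only differ through moments of order above [2 D + 1]. If
    [D] is about [ln r] and [a ^ 2] is about [r ln r / n], the second-moment
    bound [mixture_difference_le] makes the contribution of one pair at most
    [2 / r ^ 2], and replacing the pairs one at a time ([hybrid_le]) costs at
    most [1 / r] in total. The means of [|eta|] concentrate by Chebyshev's
    inequality ([iid_chebyshev]) as soon as [r] is large compared with
    [(ln r) ^ 2]. The resulting separation is of order [a / D], that is the
    minimum of [1 / ln r] and [(r / (n ln r)) ^ (1/2)]. For bounded [r] this
    rate is dominated by the parametric one. *)

(** * Mixtures of product distributions *)

Section Mixtures.
Context {R : realType}.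
Implicit Types (n m : nat).

Lemma sum_prod_ffun n (T : finType) (F : 'I_n -> T -> R) :
  \sum_(z : {ffun 'I_n -> T}) \prod_l F l (z l) = \prod_l \sum_y F l y.
Proof. by rewrite bigA_distr_bigA. Qed.

Lemma sum_iid_eq1 n (T : finType) (Q : T -> R) :
  \sum_y Q y = 1 -> \sum_(z : {ffun 'I_n -> T}) \prod_l Q (z l) = 1.
Proof.
by move=> Q1; rewrite (sum_prod_ffun (fun=> Q)) big1.
Qed.

Lemma sqr_mean_le (T : finType) (q g : T -> R) :
  (forall x, 0 <= q x) -> \sum_x q x = 1 ->
  (\sum_x q x * g x) ^+ 2 <= \sum_x q x * g x ^+ 2.
Proof.
move=> q0 q1; set s := \sum_x q x * g x.
rewrite -subr_ge0; have -> : \sum_x q x * g x ^+ 2 - s ^+ 2 =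
    \sum_x q x * (g x - s) ^+ 2.
  transitivity (\sum_x (q x * g x ^+ 2 - 2 * s * (q x * g x) + s ^+ 2 * q x)).
    rewrite big_split sumrB /= -!mulr_sumr q1 -/s; ring.
  by apply: eq_bigr => x _; ring.
by apply: sumr_ge0 => x _; rewrite mulr_ge0 ?sqr_ge0.
Qed.

(** Second-moment bound: expanding the square of the likelihood-ratio
    difference of the mixture, the cross terms integrate to
    [(1 + t k * t k' * v) ^+ n], whose binomial expansion separates the moments
    of [nu]; the ones that vanish do not contribute. *)
Lemma mixture_difference_le n (T K : finType) (Q phi : T -> R) (v : R)
    (nu t : K -> R) (h : {ffun 'I_n -> T} -> R) :
  (forall y, 0 <= Q y) -> \sum_y Q y = 1 -> \sum_y Q y * phi y = 0 ->
  \sum_y Q y * phi y ^+ 2 = v -> (forall z, `|h z| <= 1) ->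
  (\sum_k nu k * \sum_z h z * \prod_l (Q (z l) * (1 + t k * phi (z l)))) ^+ 2
  <= \sum_(j < n.+1) 'C(n, j)%:R * v ^+ j * (\sum_k nu k * t k ^+ j) ^+ 2.
Proof.
move=> Q0 Q1 Qphi Qphi2 h1.
pose q (z : {ffun 'I_n -> T}) := \prod_l Q (z l).
pose F (z : {ffun 'I_n -> T}) := \sum_k nu k * \prod_l (1 + t k * phi (z l)).
have -> : \sum_k nu k * \sum_z h z * \prod_l (Q (z l) * (1 + t k * phi (z l)))
    = \sum_z q z * (h z * F z).
  under eq_bigr do rewrite mulr_sumr.
  rewrite exchange_big /=; apply: eq_bigr => z _.
  rewrite /F !mulr_sumr; apply: eq_bigr => k _.
  by rewrite big_split /= -/(q z); ring.
have q0 z : 0 <= q z by apply: prodr_ge0.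
have q1 : \sum_z q z = 1 by exact: sum_iid_eq1.
apply: (le_trans (sqr_mean_le _ q0 q1)).
apply: (@le_trans _ _ (\sum_z q z * F z ^+ 2)).
  apply: ler_sum => z _; apply: ler_wpM2l => //.
  rewrite exprMn -[leRHS]mul1r; apply: ler_wpM2r; first exact: sqr_ge0.
  by rewrite -real_normK ?num_real ?expr_le1.
have cross k k' : \sum_z q z * ((\prod_l (1 + t k * phi (z l)))
    * (\prod_l (1 + t k' * phi (z l)))) = (1 + t k * t k' * v) ^+ n.
  rewrite (eq_bigr (fun z : {ffun 'I_n -> T} => \prod_l
     (Q (z l) * ((1 + t k * phi (z l)) * (1 + t k' * phi (z l)))))); last first.
    by move=> z _; rewrite /q -!big_split.
  rewrite (sum_prod_ffun (fun _ y =>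
     Q y * ((1 + t k * phi y) * (1 + t k' * phi y)))) prodr_const card_ord.
  congr (_ ^+ _).
  transitivity (\sum_y (Q y + (t k + t k') * (Q y * phi y)
                       + t k * t k' * (Q y * phi y ^+ 2))).
    by apply: eq_bigr => y _; ring.
  by rewrite !big_split /= -!mulr_sumr Q1 Qphi Qphi2; ring.
have -> : \sum_z q z * F z ^+ 2 =
    \sum_k \sum_k' nu k * nu k' * (1 + t k * t k' * v) ^+ n.
  transitivity (\sum_z \sum_k \sum_k' nu k * nu k' * (q z *
      ((\prod_l (1 + t k * phi (z l))) * (\prod_l (1 + t k' * phi (z l)))))).
    apply: eq_bigr => z _.
    rewrite /F expr2 mulr_suml mulr_sumr; apply: eq_bigr => k _.
    rewrite !mulr_sumr; apply: eq_bigr => k' _; ring.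
  rewrite exchange_big /=; apply: eq_bigr => k _.
  rewrite exchange_big /=; apply: eq_bigr => k' _.
  by rewrite -mulr_sumr cross.
rewrite le_eqVlt; apply/orP; left; apply/eqP.
transitivity (\sum_k \sum_k' \sum_(j < n.+1)
   'C(n, j)%:R * v ^+ j * ((nu k * t k ^+ j) * (nu k' * t k' ^+ j))).
  apply: eq_bigr => k _; apply: eq_bigr => k' _.
  rewrite exprDn mulr_sumr; apply: eq_bigr => j _.
  by rewrite expr1n mul1r !exprMn -mulr_natl; ring.
under eq_bigr do rewrite exchange_big.
rewrite exchange_big /=; apply: eq_bigr => j _.
rewrite expr2 mulr_suml mulr_sumr; apply: eq_bigr => k _.
by rewrite !mulr_sumr.
Qed.

Definition coord_update {m} {K : finType} (u : {ffun 'I_m -> K}) (i : 'I_m)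
    (k : K) : {ffun 'I_m -> K} :=
  [ffun l => if l == i then k else u l].

(** Replacing the law of one coordinate at a time: the coordinate [i] is
    resampled by the involution exchanging [u i] with an independent [k]. *)
Lemma hybrid_le m (K : finType) (mu0 mu1 : K -> R)
    (G : {ffun 'I_m -> K} -> R) (d : R) :
  (forall k, 0 <= mu0 k) -> (forall k, 0 <= mu1 k) ->
  \sum_k mu0 k = 1 -> \sum_k mu1 k = 1 ->
  (forall i (u : {ffun 'I_m -> K}),
    `|\sum_k (mu1 k - mu0 k) * G (coord_update u i k)| <= d) ->
  `|\sum_(u : {ffun 'I_m -> K}) (\prod_i mu1 (u i) - \prod_i mu0 (u i)) * G u|
  <= m%:R * d.
Proof.
move=> mu00 mu10 s0 s1 Hd.
pose mu (j : nat) (i : 'I_m) k := if (i < j)%N then mu1 k else mu0 k.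
pose W j (u : {ffun 'I_m -> K}) := \prod_i mu j i (u i).
have -> : \sum_(u : {ffun 'I_m -> K}) (\prod_i mu1 (u i) - \prod_i mu0 (u i)) * G u =
    \sum_(0 <= j < m) \sum_u (W j.+1 u - W j u) * G u.
  rewrite exchange_big /=; apply: eq_bigr => u _.
  rewrite -mulr_suml telescope_sumr //; congr ((_ - _) * _).
  by apply: eq_bigr => i _; rewrite /mu ltn_ord.
have -> : m%:R * d = \sum_(0 <= j < m) d.
  by rewrite sumr_const_nat subn0 mulr_natl.
rewrite !big_mkord; apply: (le_trans (ler_norm_sum _ _ _)); apply: ler_sum.
move=> j _.
pose A (u : {ffun 'I_m -> K}) := \prod_(i | i != j) mu j i (u i).
have WE u : W j u = A u * mu0 (u j).
  by rewrite /W (bigD1 j) //= mulrC; congr (_ * _); rewrite /mu ltnn.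
have WSE u : W j.+1 u = A u * mu1 (u j).
  rewrite /W (bigD1 j) //= mulrC; congr (_ * _); last by rewrite /mu ltnSn.
  apply: eq_bigr => i ij; rewrite /mu ltnS leq_eqVlt.
  by rewrite (negbTE (ij : val i != val j)).
have AU u k : A (coord_update u j k) = A u.
  by apply: eq_bigr => i ij; rewrite ffunE (negbTE ij).
have A0 u : 0 <= A u by apply: prodr_ge0 => i _; rewrite /mu; case: ifP.
pose sw (p : {ffun 'I_m -> K} * K) := (coord_update p.1 j p.2, p.1 j).
have swK : involutive sw.
  case=> u k; rewrite /sw /= ffunE eqxx; congr (_, _).
  apply/ffunP => i; rewrite !ffunE; by case: eqP => [->|].
have -> : \sum_u (W j.+1 u - W j u) * G u =
   \sum_u A u * mu0 (u j) * \sum_k (mu1 k - mu0 k) * G (coord_update u j k).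
  transitivity (\sum_u \sum_k A u * (mu1 (u j) - mu0 (u j)) * G u * mu0 k).
    apply: eq_bigr => u _; rewrite -mulr_sumr s0 WE WSE; ring.
  rewrite pair_big /= (reindex_inj (inv_inj swK)) /=.
  under [RHS]eq_bigr do rewrite mulr_sumr.
  rewrite pair_big /=; apply: eq_bigr => -[u k] _ /=.
  by rewrite AU ffunE eqxx; ring.
apply: (le_trans (ler_norm_sum _ _ _)).
have -> : d = \sum_u A u * mu0 (u j) * d.
  rewrite -mulr_suml (eq_bigr (W j)); last by move=> u _; rewrite WE.
  rewrite /W (sum_prod_ffun (mu j)) big1 ?mul1r // => i _.
  by rewrite /mu; case: (i < j)%N.
apply: ler_sum => u _; rewrite normrM ger0_norm ?mulr_ge0 //.
by apply: ler_wpM2l; rewrite ?mulr_ge0.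
Qed.

Lemma iid_second_moment m (K : finType) (mu g : K -> R) :
  \sum_k mu k = 1 -> \sum_k mu k * g k = 0 ->
  \sum_(u : {ffun 'I_m -> K}) (\prod_i mu (u i)) * (\sum_i g (u i)) ^+ 2 =
  m%:R * \sum_k mu k * g k ^+ 2.
Proof.
move=> mu1 mug.
transitivity (\sum_i \sum_i' \sum_(u : {ffun 'I_m -> K})
    (\prod_l mu (u l)) * (g (u i) * g (u i'))).
  transitivity (\sum_(u : {ffun 'I_m -> K}) \sum_i \sum_i'
      (\prod_l mu (u l)) * (g (u i) * g (u i'))).
    apply: eq_bigr => u _; rewrite expr2 mulr_suml mulr_sumr.
    by apply: eq_bigr => i _; rewrite !mulr_sumr.
  by rewrite exchange_big; apply: eq_bigr => i _; rewrite exchange_big.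
rewrite -[m in RHS]card_ord mulr_natl -sumr_const; apply: eq_bigr => i _.
have E i' : \sum_(u : {ffun 'I_m -> K}) (\prod_l mu (u l)) * (g (u i) * g (u i'))
   = \prod_l \sum_k mu k * ((if l == i then g k else 1) *
                            (if l == i' then g k else 1)).
  rewrite -(sum_prod_ffun (fun l k => mu k * ((if l == i then g k else 1) *
                            (if l == i' then g k else 1)))).
  apply: eq_bigr => u _; rewrite !big_split /=; congr (_ * (_ * _)).
    by rewrite (bigD1 i) //= eqxx big1 ?mulr1 // => l /negbTE ->.
  by rewrite (bigD1 i') //= eqxx big1 ?mulr1 // => l /negbTE ->.
rewrite (bigD1 i) //= [X in _ + X]big1 => [|i' ii'].
  rewrite addr0 E (bigD1 i) //= eqxx [X in _ * X]big1 ?mulr1 => [|l li].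
    by apply: eq_bigr => k _; rewrite expr2.
  rewrite (negbTE li) -[RHS]mu1; by apply: eq_bigr => k _; rewrite !mulr1.
rewrite E (bigD1 i) //= eqxx eq_sym (negbTE ii').
by under eq_bigr do rewrite mulr1; rewrite mug mul0r.
Qed.

Lemma iid_chebyshev m (K : finType) (mu g : K -> R) (bad : pred {ffun 'I_m -> K})
    (s : R) :
  (forall k, 0 <= mu k) -> \sum_k mu k = 1 -> \sum_k mu k * g k = 0 ->
  (forall k, `|g k| <= 1) -> 0 < s ->
  (forall u, bad u -> s <= `|\sum_i g (u i)|) ->
  \sum_(u : {ffun 'I_m -> K} | bad u) \prod_i mu (u i) <= m%:R / s ^+ 2.
Proof.
move=> mu0 mu1 mug g1 s0 Hbad.
rewrite ler_pdivlMr ?exprn_gt0 //.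
have W0 (u : {ffun 'I_m -> K}) : 0 <= \prod_i mu (u i) by apply: prodr_ge0.
apply: (@le_trans _ _ (\sum_(u : {ffun 'I_m -> K})
     (\prod_i mu (u i)) * (\sum_i g (u i)) ^+ 2)).
  rewrite mulr_suml big_mkcond; apply: ler_sum => u _.
  case: ifP => [/Hbad H|_]; last by rewrite mulr_ge0 ?sqr_ge0.
  apply: ler_wpM2l => //; rewrite -[leRHS]real_normK ?num_real //.
  by rewrite ler_sqr ?nnegrE // ltW.
rewrite iid_second_moment // -[leRHS]mulr1; apply: ler_wpM2l => //.
rewrite -[leRHS]mu1; apply: ler_sum => k _.
rewrite -[leRHS]mulr1; apply: ler_wpM2l => //.
by rewrite -real_normK ?num_real ?expr_le1.
Qed.

End Mixtures.

(** * Two measures that share their low moments but not their mean modulus *)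

Section MomentMatching.
Context {R : realType}.

Lemma cos_add_2npi (x : R) n : cos (x + 2 * pi * n%:R) = cos x.
Proof.
elim: n => [|n IH]; first by rewrite mulr0 addr0.
have -> : x + 2 * pi * n.+1%:R = x + 2 * pi * n%:R + pi *+ 2.
  by rewrite -mulr_natl -natr1; ring.
by rewrite cosD2pi IH.
Qed.

Lemma sin_add_2npi (x : R) n : sin (x + 2 * pi * n%:R) = sin x.
Proof.
elim: n => [|n IH]; first by rewrite mulr0 addr0.
have -> : x + 2 * pi * n.+1%:R = x + 2 * pi * n%:R + pi *+ 2.
  by rewrite -mulr_natl -natr1; ring.
by rewrite sinD2pi IH.
Qed.

Lemma sin_le_id (x : R) : 0 <= x -> sin x <= x.
Proof.
move=> x0.
have [|c _ E] := @MVT_segment R sin cos 0 x x0.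
  exact/continuous_subspaceT/continuous_sin.
move: E; rewrite sin0 !subr0 => ->.
by rewrite -[leRHS]mul1r; apply: ler_wpM2r => //; exact: cos_le1.
Qed.

(** Multiplied by twice the sine of half a step, the sum telescopes over [p] full
    periods. *)
Lemma sum_cos_grid_eq0 (M p : nat) (b : R) : (0 < p < M)%N ->
  \sum_(i < M) cos (p%:R * (2 * pi / M%:R * i%:R) + b) = 0.
Proof.
move=> /andP[p0 pM].
have M0 : M%:R != 0 :> R by rewrite pnatr_eq0; case: (M) pM.
have Mp : 0 < M%:R :> R by rewrite lt_def M0 ler0n.
pose w : R := pi * p%:R / M%:R.
have sw : sin w != 0.
  apply: lt0r_neq0; apply: sin_gt0_pi; rewrite /w; apply/andP; split.
    by rewrite divr_gt0 // mulr_gt0 ?pi_gt0 // ltr0n.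
  by rewrite ltr_pdivrMr // ltr_pM2l ?pi_gt0 // ltr_nat.
apply: (mulfI sw); apply: (mulfI (_ : 2 != 0 :> R)) => //.
rewrite !mulr0 mulr_sumr mulr_sumr.
pose f (i : nat) := sin (2 * w * i%:R + b - w).
rewrite (eq_bigr (fun i : 'I_M => f i.+1 - f i)) => [|i _]; last first.
  have -> : p%:R * (2 * pi / M%:R * i%:R) + b = 2 * w * i%:R + b.
    by rewrite /w; field.
  rewrite /f; set y := 2 * w * i%:R + b.
  have -> : 2 * w * i.+1%:R + b - w = y + w by rewrite /y -natr1; ring.
  by rewrite sinD sinB; ring.
rewrite -(big_mkord xpredT (fun i => f i.+1 - f i)) telescope_sumr // /f.
have -> : 2 * w * M%:R + b - w = 2 * w * 0%:R + b - w + 2 * pi * p%:R.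
  by rewrite /w; field.
by rewrite sin_add_2npi subrr.
Qed.

(** Multiplying by [sin x] shifts the frequency [p] by one, so [a] factors
    keep it strictly between [0] and [M]. *)
Lemma sum_cos_sin_pow_grid_eq0 (M a p : nat) (b : R) :
  (a < p)%N -> (p + a < M)%N ->
  \sum_(i < M) cos (p%:R * (2 * pi / M%:R * i%:R) + b)
               * sin (2 * pi / M%:R * i%:R) ^+ a = 0.
Proof.
elim: a p b => [|a IH] p b ap pM.
  under eq_bigr do rewrite expr0 mulr1.
  by apply: sum_cos_grid_eq0; rewrite ap -(addn0 p).
case: p ap pM => // p ap pM.
have H1 : (a < p.+2)%N by lia.
have H2 : (p.+2 + a < M)%N by lia.
have H3 : (p + a < M)%N by lia.
have I1 := IH p.+2 (b - pi / 2) H1 H2.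
have I2 := IH p (b - pi / 2) ap H3.
rewrite -[RHS](mulr0 (2^-1 : R)) -[X in _ = _ * X](subrr 0) -[X in X - _]I1.
rewrite -[X in _ - X]I2 -sumrB mulr_sumr; apply: eq_bigr => i _.
set x := 2 * pi / M%:R * i%:R.
rewrite !addrA !cosBpihalf exprS.
have -> : p.+2%:R * x + b = (p.+1%:R * x + b) + x by rewrite -(natr1 p.+1); ring.
have -> : p%:R * x + b = (p.+1%:R * x + b) - x by rewrite -(natr1 p); ring.
by rewrite sinD sinB; field.
Qed.

(** The Fejer kernel [(sin (D x) / sin x) ^+ 2], in a form that needs no
    division and is visibly nonnegative. *)
Definition fejer D (x : R) : R :=
  (\sum_(l < D) cos (2 * l%:R * x)) ^+ 2 + (\sum_(l < D) sin (2 * l%:R * x)) ^+ 2.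

Lemma fejer_ge0 D x : 0 <= fejer D x.
Proof. by rewrite addr_ge0 ?sqr_ge0. Qed.

Lemma fejer_sum_cos D x :
  fejer D x = \sum_(l < D) \sum_(l' < D) cos ((2 * l%:R - 2 * l'%:R) * x).
Proof.
rewrite /fejer !expr2 !mulr_suml -big_split; apply: eq_bigr => l _ /=.
rewrite !mulr_sumr -big_split; apply: eq_bigr => l' _ /=.
by rewrite mulrBl cosB.
Qed.

(** Both sums that define the kernel telescope after multiplication by
    [2 * sin x]. *)
Lemma fejer_mul_sqr_sin D x :
  fejer D x * sin x ^+ 2 = (1 - cos (2 * D%:R * x)) / 2.
Proof.
have C : 2 * sin x * (\sum_(l < D) cos (2 * l%:R * x)) =
    sin (2 * D%:R * x - x) + sin x.
  pose f (l : nat) := sin (2 * l%:R * x - x).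
  rewrite mulr_sumr (eq_bigr (fun l : 'I_D => f l.+1 - f l)) => [|l _].
    rewrite -(big_mkord xpredT (fun l => f l.+1 - f l)) telescope_sumr // /f.
    by rewrite mulr0 mul0r sub0r sinN opprK.
  rewrite /f; have -> : 2 * l.+1%:R * x - x = 2 * l%:R * x + x.
    by rewrite -natr1; ring.
  by rewrite sinD sinB; ring.
have S : 2 * sin x * (\sum_(l < D) sin (2 * l%:R * x)) =
    cos x - cos (2 * D%:R * x - x).
  pose f (l : nat) := - cos (2 * l%:R * x - x).
  rewrite mulr_sumr (eq_bigr (fun l : 'I_D => f l.+1 - f l)) => [|l _].
    rewrite -(big_mkord xpredT (fun l => f l.+1 - f l)) telescope_sumr // /f.
    by rewrite mulr0 mul0r sub0r cosN; ring.
  rewrite /f; have -> : 2 * l.+1%:R * x - x = 2 * l%:R * x + x.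
    by rewrite -natr1; ring.
  by rewrite cosD cosB; ring.
set A := \sum_(l < D) cos _ in C; set B := \sum_(l < D) sin _ in S.
have -> : fejer D x * sin x ^+ 2 =
    4^-1 * ((2 * sin x * A) ^+ 2 + (2 * sin x * B) ^+ 2).
  by rewrite /fejer -/A -/B; field.
rewrite C S; set y := 2 * D%:R * x - x.
have -> : 2 * D%:R * x = y + x by rewrite /y; ring.
have := cos2Dsin2 x; have := cos2Dsin2 y; rewrite (cosD y x) => Ey Ex.
transitivity (4^-1 * ((cos x ^+ 2 + sin x ^+ 2) + (cos y ^+ 2 + sin y ^+ 2) +
   2 * (sin y * sin x - cos x * cos y))); first by ring.
by rewrite Ex Ey; field.
Qed.

Lemma sum_by_four n (f : nat -> R) :
  \sum_(i < 4 * n) f i =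
  \sum_(b < n) (f (4 * b)%N + f (4 * b).+1 + f (4 * b).+2 + f (4 * b).+3).
Proof.
elim: n => [|n IH]; first by rewrite !big_ord0.
rewrite [RHS]big_ord_recr /= -IH mulnS addnC !addnS addn0 !big_ord_recr /=.
by rewrite !addrA.
Qed.

Lemma inv_le_mean_inv (x y z : R) : 0 < x -> 0 < y -> x + y <= 2 * z ->
  z^-1 <= (x^-1 + y^-1) / 2.
Proof.
move=> x0 y0 xyz; have z0 : 0 < z by lra.
have -> : (x^-1 + y^-1) / 2 = (x + y) / (2 * (x * y)).
  by field; rewrite !gt_eqF.
rewrite ler_pdivlMr ?mulr_gt0 // mulrC ler_pdivrMr //.
have := sqr_ge0 (x - y).
nra.
Qed.

End MomentMatching.

Section ChebyshevGrid.
Context {R : realType}.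
Variable D : nat.
Hypothesis D_gt0 : (0 < D)%N.

Let angle (i : nat) : R := 2 * pi / (8 * D)%:R * i%:R.

Let D0 : D%:R != 0 :> R.
Proof. by rewrite pnatr_eq0 -lt0n. Qed.

Let Dp : 0 < D%:R :> R.
Proof. by rewrite ltr0n. Qed.

Lemma angleE i : angle i = pi * i%:R / (4 * D%:R).
Proof. by rewrite /angle natrM; field. Qed.

Lemma sign_cos_angle i : (-1) ^+ i = cos (4 * D%:R * angle i) :> R.
Proof.
have -> : 4 * D%:R * angle i = pi * i%:R by rewrite angleE; field.
elim: i => [|i IH]; first by rewrite mulr0 cos0.
have -> : pi * i.+1%:R = pi * i%:R + pi :> R by rewrite -natr1; ring.
by rewrite exprSr IH cosDpi mulrN1.
Qed.

(** The sign and the kernel together have frequencies between [2 D + 2] and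
    [6 D - 2], so the alternating kernel annihilates all powers of [sin] up to
    [2 D + 1]. *)
Lemma alternating_fejer_moment_eq0 j : (j <= 2 * D + 1)%N ->
  \sum_(i < 8 * D) (-1) ^+ i * fejer D (angle i) * sin (angle i) ^+ j = 0.
Proof.
move=> jD.
pose c (l l' : nat) (x : R) := cos ((4 * D + 2 * l - 2 * l')%:R * x + 0).
have c0 l l' : (l < D)%N -> (l' < D)%N ->
    \sum_(i < 8 * D) c l l' (angle i) * sin (angle i) ^+ j = 0.
  by move=> lD lD'; apply: sum_cos_sin_pow_grid_eq0; lia.
transitivity (\sum_(l < D) \sum_(l' < D) 2^-1 *
   (\sum_(i < 8 * D) c l l' (angle i) * sin (angle i) ^+ j +
    \sum_(i < 8 * D) c l' l (angle i) * sin (angle i) ^+ j)); last first.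
  rewrite big1 // => l _; rewrite big1 // => l' _.
  by rewrite !c0 // addr0 mulr0.
under [RHS]eq_bigr do under eq_bigr do rewrite -big_split mulr_sumr.
under [RHS]eq_bigr do rewrite exchange_big.
rewrite [RHS]exchange_big /=; apply: eq_bigr => i _.
rewrite fejer_sum_cos mulr_sumr mulr_suml; apply: eq_bigr => l _.
rewrite mulr_sumr mulr_suml; apply: eq_bigr => l' _.
rewrite sign_cos_angle /c !addr0; have lD := ltn_ord l; have lD' := ltn_ord l'.
rewrite !natrB; [|lia|lia]; rewrite !(natrD _ (4 * D)) !natrM; set x := angle i.
have -> : (4 * D%:R + 2 * l%:R - 2 * l'%:R) * x =
  4 * D%:R * x + (2 * l%:R - 2 * l'%:R) * x by ring.
have -> : (4 * D%:R + 2 * l'%:R - 2 * l%:R) * x =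
  4 * D%:R * x - (2 * l%:R - 2 * l'%:R) * x by ring.
by rewrite cosD cosB; field.
Qed.

(** In the double sum of cosines only the diagonal has a frequency that is a
    multiple of the number of grid points. *)
Lemma sum_fejer : \sum_(i < 8 * D) fejer D (angle i) = 8 * D%:R ^+ 2.
Proof.
have E (l l' : 'I_D) : \sum_(i < 8 * D) cos ((2 * l%:R - 2 * l'%:R) * angle i)
    = (l == l')%:R * 8 * D%:R.
  case: (ltngtP l l') => [ll'|ll'|/val_inj ->].
  - rewrite (negbTE (_ : l != l')) ?mul0r; last by rewrite -val_eqE neq_ltn ll'.
    rewrite -[RHS](@sum_cos_grid_eq0 R (8 * D) (2 * (l' - l)) 0).
      apply: eq_bigr => i _; rewrite addr0 -cosN -mulNr natrM (natrB _ (ltnW ll')).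
      by congr cos; rewrite /angle; ring.
    have := ltn_ord l'; lia.
  - rewrite (negbTE (_ : l != l')) ?mul0r; last by rewrite -val_eqE neq_ltn ll' orbT.
    rewrite -[RHS](@sum_cos_grid_eq0 R (8 * D) (2 * (l - l')) 0).
      apply: eq_bigr => i _; rewrite addr0 natrM (natrB _ (ltnW ll')).
      by congr cos; rewrite /angle; ring.
    have := ltn_ord l; lia.
  - rewrite eqxx; under eq_bigr do rewrite subrr mul0r cos0.
    by rewrite sumr_const card_ord natrM mul1r.
under eq_bigr do rewrite fejer_sum_cos.
rewrite exchange_big; under eq_bigr do rewrite exchange_big.
under eq_bigr do under eq_bigr do rewrite E.
transitivity (\sum_(l < D) 8 * D%:R : R).
  apply: eq_bigr => l _; rewrite (bigD1 l) //= eqxx big1 => [|l' /negbTE l'l].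
    by rewrite addr0 mul1r.
  by rewrite eq_sym l'l !mul0r.
by rewrite sumr_const card_ord -[LHS]mulr_natl; ring.
Qed.

Let G i : R := fejer D (angle i) * `|sin (angle i)|.
Let s (i : nat) : R := sin (angle i).

Lemma fejer_norm_sin i : 0 <= s i ->
  G i = (1 - cos (pi / 2 * i%:R)) / 2 * (s i)^-1.
Proof.
rewrite /s => si; rewrite /G ger0_norm //.
have -> : pi / 2 * i%:R = 2 * D%:R * angle i by rewrite angleE; field.
rewrite -fejer_mul_sqr_sin expr2 -!mulrA.
have [->|sn0] := eqVneq (sin (angle i)) 0; first by rewrite !mul0r.
by rewrite divff // mulr1.
Qed.

Lemma sin_angle_gt0 i : (0 < i < 4 * D)%N -> 0 < s i.
Proof.
move=> /andP[i0 iD]; apply: sin_gt0_pi; rewrite angleE.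
rewrite divr_gt0 ?mulr_gt0 ?pi_gt0 ?ltr0n //=.
rewrite ltr_pdivrMr ?mulr_gt0 // ltr_pM2l ?pi_gt0 //.
by rewrite -natrM ltr_nat.
Qed.

Lemma angle_shift_half i : angle (4 * D + i) = angle i + pi.
Proof. by rewrite !angleE natrD natrM; field. Qed.

Lemma angleD i j : angle (i + j) = angle i + angle j.
Proof. by rewrite /angle natrD mulrDr. Qed.

(** As [D * angle i = pi i / 4], the numerator [sin (pi i / 4) ^ 2] of the kernel
    is 0, 1/2, 1, 1/2 according to the residue of [i] modulo 4. *)
Lemma alternating_block b : (b < D)%N ->
  G (4 * b) - G (4 * b).+1 + G (4 * b).+2 - G (4 * b).+3 =
  (s (4 * b).+2)^-1 - ((s (4 * b).+1)^-1 + (s (4 * b).+3)^-1) / 2.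
Proof.
move=> bD.
have P (c : nat) : (c < 4)%N -> 0 <= s (4 * b + c).
  move=> c4; have [->|] := eqVneq (4 * b + c)%N 0%N.
    by rewrite /s /angle mulr0 sin0.
  by rewrite -lt0n => bc; apply/ltW/sin_angle_gt0; rewrite bc; lia.
have C (c : nat) : cos (pi / 2 * (4 * b + c)%:R) = cos (pi / 2 * c%:R) :> R.
  rewrite -[RHS](@cos_add_2npi R _ b); congr cos.
  by rewrite natrD natrM; field.
have H c (c4 : (c < 4)%N) :
    G (4 * b + c) = (1 - cos (pi / 2 * c%:R)) / 2 * (s (4 * b + c))^-1.
  by rewrite fejer_norm_sin ?P // C.
have c0 : cos (pi / 2 * 0%:R) = 1 :> R by rewrite mulr0 cos0.
have c1 : cos (pi / 2 * 1%:R) = 0 :> R by rewrite mulr1 cos_pihalf.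
have c2 : cos (pi / 2 * 2%:R) = -1 :> R by rewrite -cospi; congr cos; field.
have c3 : cos (pi / 2 * 3%:R) = 0 :> R.
  have -> : pi / 2 * 3%:R = pi / 2 + pi :> R by field.
  by rewrite cosDpi cos_pihalf oppr0.
move: (H 0%N isT) (H 1%N isT) (H 2%N isT) (H 3%N isT).
rewrite c0 c1 c2 c3 addn0 addn1 addn2 addn3 => -> -> -> ->.
set i1 := (s (4 * b).+1)^-1; set i2 := (s (4 * b).+2)^-1.
set i3 := (s (4 * b).+3)^-1; set i0 := (s (4 * b))^-1.
by field.
Qed.

(** Convexity of [1 / sin] on the interval from 0 to [pi]. *)
Lemma block_le0 b : (b < D)%N ->
  (s (4 * b).+2)^-1 - ((s (4 * b).+1)^-1 + (s (4 * b).+3)^-1) / 2 <= 0.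
Proof.
move=> bD; rewrite subr_le0.
have p1 : 0 < s (4 * b).+1 by apply: sin_angle_gt0; lia.
have p2 : 0 < s (4 * b).+2 by apply: sin_angle_gt0; lia.
have p3 : 0 < s (4 * b).+3 by apply: sin_angle_gt0; lia.
apply: inv_le_mean_inv => //.
have E1 : angle (4 * b).+1 = angle (4 * b).+2 - angle 1.
  by rewrite -[(4 * b).+2]addn1 angleD addrK.
have E3 : angle (4 * b).+3 = angle (4 * b).+2 + angle 1.
  by rewrite -[(4 * b).+3]addn1 angleD.
rewrite {1 2}/s E1 E3 sinB sinD -/(s _).
have := cos_le1 (angle 1); nra.
Qed.

(** The angles 1, 2, 3 times [pi / (4 D)] lie where [1 / sin] behaves like the
    inverse function, whose convexity defect there is of order [D]. *)
Lemma first_block_le :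
  (s 2)^-1 - ((s 1)^-1 + (s 3)^-1) / 2 <= - (D%:R / 15).
Proof.
have p1 : 0 < s 1 by apply: sin_angle_gt0; lia.
have p2 : 0 < s 2 by apply: sin_angle_gt0; lia.
have p3 : 0 < s 3 by apply: sin_angle_gt0; lia.
set x := angle 1; set c := cos x.
have E2 : s 2 = 2 * s 1 * c.
  by rewrite /s (angleD 1 1) -/x sinD -/c; ring.
have E3 : s 3 = s 1 * (4 * c ^+ 2 - 1).
  rewrite /s (angleD 2 1) (angleD 1 1) -/x 2!sinD cosD -/c.
  have := cos2Dsin2 x; rewrite -/c => h.
  transitivity (sin x * (3 * c ^+ 2 - sin x ^+ 2)); first by ring.
  by congr (_ * _); lra.
have c0 : 0 < c by move: p2; rewrite E2 pmulr_rgt0 // mulr_gt0.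
have w0 : 0 < 4 * c ^+ 2 - 1 by move: p3; rewrite E3 pmulr_rgt0.
have c1 : c <= 1 by exact: cos_le1.
have sD : s 1 * D%:R <= 1.
  apply: (@le_trans _ _ (x * D%:R)).
    apply: ler_wpM2r; first exact: ltW.
    by apply: sin_le_id; rewrite /x angleE divr_ge0 ?mulr_ge0 ?pi_ge0 ?ler0n.
  rewrite /x angleE; have -> : pi * 1 / (4 * D%:R) * D%:R = pi / 4 :> R by field.
  have := @pihalf_lt2 R; lra.
have key : 15^-1 <= 2 * c ^+ 2 / (4 * c ^+ 2 - 1) - (2 * c)^-1.
  have -> : 2 * c ^+ 2 / (4 * c ^+ 2 - 1) - (2 * c)^-1 =
      (4 * c ^+ 3 - 4 * c ^+ 2 + 1) / (2 * c * (4 * c ^+ 2 - 1)).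
    by field; rewrite !gt_eqF.
  rewrite ler_pdivlMr ?mulr_gt0 //.
  (* for [c >= 0] the numerator is smallest at [c = 2 / 3], with value 11 / 27 *)
  have h1 : 0 <= (c - 2 / 3) ^+ 2 * (c + 3^-1).
    by rewrite mulr_ge0 ?sqr_ge0 // addr_ge0 // ltW.
  have h2 : c * (4 * c ^+ 2 - 1) <= 3.
    have : c ^+ 2 <= 1 by rewrite exprn_ile1 // ltW.
    nra.
  have h3 : 4 * c ^+ 3 - 4 * c ^+ 2 + 1 = 4 * ((c - 2 / 3) ^+ 2 * (c + 3^-1)) + 11 / 27.
    by field.
  rewrite h3; lra.
rewrite E2 E3.
have -> : (2 * s 1 * c)^-1 - ((s 1)^-1 + (s 1 * (4 * c ^+ 2 - 1))^-1) / 2 =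
   - ((2 * c ^+ 2 / (4 * c ^+ 2 - 1) - (2 * c)^-1) / s 1).
  by field; rewrite !gt_eqF.
rewrite lerN2 ler_pdivlMr //.
apply: le_trans key; rewrite mulrAC ler_pdivrMr //; lra.
Qed.

(** The blocks all have the same sign, so none of them is cancelled and the first
    one alone gives the bound; the shift by [pi] doubles it. *)
Lemma alternating_fejer_norm_sin_le :
  \sum_(i < 8 * D) (-1) ^+ i * G i <= - (2 * D%:R / 15).
Proof.
have sign4 n : (-1) ^+ (4 * n) = 1 :> R by rewrite exprM -signr_odd expr1n.
have half : \sum_(i < 8 * D) (-1) ^+ i * G i = 2 * \sum_(i < 4 * D) (-1) ^+ i * G i.
  rewrite -!(big_mkord xpredT (fun i => (-1) ^+ i * G i)).
  rewrite (@big_cat_nat _ _ _ (4 * D)%N) //=; last by rewrite leq_pmul2r.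
  rewrite -{2}[(4 * D)%N]add0n big_addn.
  have -> : (8 * D - 4 * D = 4 * D)%N by lia.
  rewrite mulr_natl mulr2n; congr (_ + _); apply: eq_bigr => i _.
  rewrite exprD sign4 mulr1; congr (_ * _).
  rewrite /G addnC angle_shift_half sinDpi normrN; congr (_ * _).
  rewrite !fejer_sum_cos; apply: eq_bigr => l _; apply: eq_bigr => l' _.
  rewrite -(@cos_add_2npi R _ l') -[RHS](@cos_add_2npi R _ l); congr cos; ring.
rewrite half (@sum_by_four R D (fun i => (-1) ^+ i * G i)).
have -> : \sum_(b < D) ((-1) ^+ (4 * b) * G (4 * b) + (-1) ^+ (4 * b).+1 * G (4 * b).+1
    + (-1) ^+ (4 * b).+2 * G (4 * b).+2 + (-1) ^+ (4 * b).+3 * G (4 * b).+3) =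
   \sum_(b < D) ((s (4 * b).+2)^-1 - ((s (4 * b).+1)^-1 + (s (4 * b).+3)^-1) / 2).
  apply: eq_bigr => b _; rewrite -alternating_block //.
  by rewrite !exprS sign4; ring.
case: (D) D_gt0 first_block_le block_le0 => // D' _ H0 Hb.
rewrite big_ord_recl /=.
have : \sum_(i < D') ((s (4 * bump 0 i).+2)^-1 - ((s (4 * bump 0 i).+1)^-1
   + (s (4 * bump 0 i).+3)^-1) / 2) <= 0.
  by apply: sumr_le0 => i _; apply: Hb; rewrite /bump /= add1n ltnS.
move: H0; rewrite !muln0; lra.
Qed.

(** The two measures are the parts of each sign of the alternating kernel,
    normalised and carried to [-1, 1] by the sine. The kernel concentrates at
    scale [1 / D] around the kink of the absolute value; this is why the gap has
    order [1 / D], whereas the alternating measure without the kernel would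
    only give [1 / D ^ 2]. *)
Lemma exists_moment_matching_measures :
  exists (K : finType) (t mu0 mu1 : K -> R),
    [/\ forall k, `|t k| <= 1,
        (forall k, 0 <= mu0 k) /\ \sum_k mu0 k = 1,
        (forall k, 0 <= mu1 k) /\ \sum_k mu1 k = 1,
        forall j, (j <= 2 * D + 1)%N -> \sum_k (mu1 k - mu0 k) * t k ^+ j = 0 &
        (30 * D%:R)^-1 <= \sum_k mu1 k * `|t k| - \sum_k mu0 k * `|t k| ].
Proof.
pose F (i : 'I_(8 * D)) := fejer D (angle i).
pose mu (b : bool) (i : 'I_(8 * D)) := (odd i == b)%:R * F i / (4 * D%:R ^+ 2).
have dD : 0 < 4 * D%:R ^+ 2 :> R by rewrite mulr_gt0 ?exprn_gt0.
have diff i : mu true i - mu false i = - ((-1) ^+ i * F i / (4 * D%:R ^+ 2)).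
  rewrite /mu -signr_odd; case: (odd i) => /=; rewrite ?expr1 ?expr0; ring.
have sum i : mu true i + mu false i = F i / (4 * D%:R ^+ 2).
  by rewrite /mu; case: (odd i) => /=; ring.
have mom j : (j <= 2 * D + 1)%N ->
    \sum_i (mu true i - mu false i) * sin (angle i) ^+ j = 0.
  move=> /alternating_fejer_moment_eq0 H.
  rewrite -[RHS](mul0r (- (4 * D%:R ^+ 2)^-1)) -[in RHS]H mulr_suml.
  by apply: eq_bigr => i _; rewrite diff -/(F i); ring.
have mu_sum b : \sum_i mu b i = 1.
  have S : \sum_i mu true i + \sum_i mu false i = 2.
    rewrite -big_split /=; under eq_bigr do rewrite sum.
    by rewrite -mulr_suml sum_fejer; field.
  have := mom 0%N isT; under eq_bigr do rewrite expr0 mulr1.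
  by rewrite sumrB; case: b; lra.
have mu_ge0 b i : 0 <= mu b i.
  by rewrite divr_ge0 ?mulr_ge0 ?ler0n ?fejer_ge0 // ltW.
exists 'I_(8 * D), (fun i : 'I_(8 * D) => sin (angle i)), (mu false), (mu true); split => //.
- by move=> i; exact: sin_max.
- rewrite -sumrB (eq_bigr (fun i : 'I_(8 * D) =>
     - ((-1) ^+ i * G i) / (4 * D%:R ^+ 2))); last first.
    by move=> i _; rewrite -mulrBl diff /G -/(F i); ring.
  rewrite -mulr_suml sumrN ler_pdivlMr //.
  have -> : (30 * D%:R)^-1 * (4 * D%:R ^+ 2) = 2 * D%:R / 15 :> R by field.
  have := alternating_fejer_norm_sin_le; lra.
Qed.

End ChebyshevGrid.

(** * Risk of a test against mixtures *)

Lemma mean_le (R : realType) (T : finType) (p f : T -> R) (a : R) :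
  is_dist p -> (forall x, f x <= a) -> \sum_x f x * p x <= a.
Proof.
move=> [p0 p1] fa; rewrite -[a]mulr1 -p1 mulr_sumr.
by apply: ler_sum => x _; apply: ler_wpM2r.
Qed.

Lemma mean_ge (R : realType) (T : finType) (p f : T -> R) (a : R) :
  is_dist p -> (forall x, a <= f x) -> a <= \sum_x f x * p x.
Proof.
move=> [p0 p1] fa; rewrite -[a]mulr1 -p1 mulr_sumr.
by apply: ler_sum => x _; apply: ler_wpM2r.
Qed.

Lemma sup_ge0 (R : realType) (E : set R) :
  has_ubound E -> (forall x, E x -> 0 <= x) -> 0 <= sup E.
Proof.
move=> ubE E0; case: (pselect (E !=set0)%classic) => [[x Ex]|].
  by apply: le_trans (E0 x Ex) _; exact: ub_le_sup.
by move=> /set0P/negP; rewrite negbK => /eqP ->; rewrite sup0.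
Qed.

Section Risk.
Context {R : realType} {X1 X2 X3 : finType}.
Implicit Types (P f : Defs.family R X1 X2 X3).

Definition dual_value f P : R :=
  - (3%:R^-1 * (\sum_u at12 f u * at12 P u + \sum_u at23 f u * at23 P u
                + \sum_u at13 f u * at13 P u)).

Lemma dual_value_le1 f P : Gplus f -> dists P -> dual_value f P <= 1.
Proof.
move=> [f12 f23 f13 _] [P12 P23 P13].
have := mean_ge P12 f12; have := mean_ge P23 f23; have := mean_ge P13 f13.
rewrite /dual_value; lra.
Qed.

Lemma dual_value_le_incompatibility f P :
  Gplus f -> dists P -> dual_value f P <= incompatibility P.
Proof.
move=> Gf dP; apply: ub_le_sup; last by exists f.
by exists 1 => _ [g Gg <-]; exact: dual_value_le1.
Qed.

Lemma zero_Gplus : @Gplus R X1 X2 X3 (Family (fun=> 0) (fun=> 0) (fun=> 0)).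
Proof. by split => *; rewrite /= ?addr0 // lerN10. Qed.

Lemma incompatibility_le1 P : dists P -> incompatibility P <= 1.
Proof.
move=> dP; apply: ge_sup; last by move=> _ [g Gg <-]; exact: dual_value_le1.
by eexists; exists (Family (fun=> 0) (fun=> 0) (fun=> 0)) => //; exact: zero_Gplus.
Qed.

Section Samples.
Context {n12 n23 n13 : nat}.
Notation smp := (sample X1 X2 X3 n12 n23 n13).
Implicit Types (psi : smp -> R).

Lemma expectationE P psi : expectation_under P psi =
  \sum_(z12 : {ffun 'I_n12 -> X1 * X2}) \sum_(z23 : {ffun 'I_n23 -> X2 * X3})
  \sum_(z13 : {ffun 'I_n13 -> X1 * X3}) psi (z12, z23, z13) *
    ((\prod_i at12 P (z12 i)) * (\prod_i at23 P (z23 i)) * (\prod_i at13 P (z13 i))).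
Proof.
rewrite pair_big pair_big /=; apply: eq_bigr => -[[z12 z23] z13] _ /=.
by [].
Qed.

Lemma likelihood_is_dist P : dists P -> is_dist (@likelihood R X1 X2 X3 n12 n23 n13 P).
Proof.
move=> [[p12 s12] [p23 s23] [p13 s13]]; split.
  by move=> z; rewrite !mulr_ge0 ?prodr_ge0.
transitivity (expectation_under P (fun=> 1) (n12 := n12) (n23 := n23) (n13 := n13)).
  by apply: eq_bigr => z _; rewrite mul1r.
rewrite expectationE -[RHS](sum_iid_eq1 n12 s12); apply: eq_bigr => z12 _.
rewrite -[RHS]mulr1 -[X in _ = _ * X](sum_iid_eq1 n23 s23) mulr_sumr; apply: eq_bigr => z23 _.
rewrite -[RHS]mulr1 -[X in _ = _ * X](sum_iid_eq1 n13 s13) mulr_sumr; apply: eq_bigr => z13 _.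
by rewrite /= mul1r.
Qed.

Lemma expectation_bounds P psi : dists P -> tests psi ->
  0 <= expectation_under P psi <= 1.
Proof.
move=> dP t; have dL := likelihood_is_dist dP; apply/andP; split.
  by apply: mean_ge => // z; case/andP: (t z).
by apply: mean_le => // z; case/andP: (t z).
Qed.

Lemma expectation_compl P psi : dists P ->
  expectation_under P (fun z => 1 - psi z) = 1 - expectation_under P psi.
Proof.
move=> /likelihood_is_dist[_ L1]; rewrite /expectation_under -[X in _ = X - _]L1 -sumrB.
by apply: eq_bigr => z _; rewrite mulrBl mul1r.
Qed.

Lemma compl_test psi : tests psi -> tests (fun z => 1 - psi z).
Proof. by move=> t z; case/andP: (t z) => *; rewrite subr_ge0 lerBlDr lerDl; apply/andP. Qed.

Lemma type1_bound psi : tests psi -> has_ubound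
  [set expectation_under P psi | P in @compatible_dists R X1 X2 X3].
Proof. by move=> t; exists 1 => _ [P [dP _] <-]; case/andP: (expectation_bounds dP t). Qed.

Lemma type2_bound rho psi : tests psi -> has_ubound
  [set expectation_under P (fun z => 1 - psi z)
     | P in @separated_dists R X1 X2 X3 rho].
Proof.
move=> t; exists 1 => _ [P [dP _] <-].
by case/andP: (expectation_bounds dP (compl_test t)).
Qed.

Lemma type1_ge0 psi : tests psi ->
  0 <= sup [set expectation_under P psi | P in @compatible_dists R X1 X2 X3].
Proof.
move=> t; apply: sup_ge0 (type1_bound t) _ => _ [P [dP _] <-].
by case/andP: (expectation_bounds dP t).
Qed.

Lemma type2_ge0 rho psi : tests psi ->
  0 <= sup [set expectation_under P (fun z => 1 - psi z)
     | P in @separated_dists R X1 X2 X3 rho].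
Proof.
move=> t; apply: sup_ge0 (type2_bound rho t) _ => _ [P [dP _] <-].
by case/andP: (expectation_bounds dP (compl_test t)).
Qed.

Lemma test_risk_ge0 rho psi : tests psi -> 0 <= test_risk rho psi.
Proof. by move=> t; rewrite addr_ge0 ?type1_ge0 ?type2_ge0. Qed.

(** Le Cam's method with two mixtures, whose components may fail to be
    compatible, or separated, on exceptional sets of small prior mass. *)
Lemma test_risk_ge_mixtures (U : finType) (P : U -> Defs.family R X1 X2 X3)
    (w0 w1 : U -> R) (good0 good1 : pred U) (rho : R) psi :
  (forall u, dists (P u)) -> is_dist w0 -> is_dist w1 ->
  (forall u, good0 u -> compatible_dists (P u)) ->
  (forall u, good1 u -> separated_dists rho (P u)) -> tests psi ->
  1 - \sum_(u | ~~ good0 u) w0 u - \sum_(u | ~~ good1 u) w1 u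
    - `|\sum_u (w1 u - w0 u) * expectation_under (P u) psi|
  <= test_risk rho psi.
Proof.
move=> dP [w00 w01] [w10 w11] G0 G1 t.
have partial (w e : U -> R) (g : pred U) (a : R) : 0 <= a ->
    (forall u, 0 <= w u) -> \sum_u w u = 1 -> (forall u, e u <= 1) ->
    (forall u, g u -> e u <= a) ->
    \sum_u w u * e u <= a + \sum_(u | ~~ g u) w u.
  move=> a0 W0 W1 e1 ea; rewrite (bigID g) /=; apply: lerD.
    apply: (@le_trans _ _ (\sum_(u | g u) w u * a)).
      by apply: ler_sum => u gu; apply: ler_wpM2l => //; exact: ea.
    rewrite -mulr_suml -[leRHS]mul1r; apply: ler_wpM2r => //.
    by rewrite -W1 [leRHS](bigID g) /= lerDl sumr_ge0.
  by apply: ler_sum => u _; rewrite -[leRHS]mulr1; apply: ler_wpM2l.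
pose e u := expectation_under (P u) psi.
have B0 := partial w0 e good0 _ (type1_ge0 t) w00 w01
   (fun u => proj2 (andP (expectation_bounds (dP u) t)))
   (fun u gu => ub_le_sup (type1_bound t) (ex_intro2 _ _ (P u) (G0 u gu) erefl)).
have e1 u : 1 - e u <= 1.
  by case/andP: (expectation_bounds (dP u) t) => e0 _; rewrite lerBlDr lerDl.
have B1 : \sum_u w1 u * (1 - e u) <=
   sup [set expectation_under P (fun z => 1 - psi z)
     | P in @separated_dists R X1 X2 X3 rho] + \sum_(u | ~~ good1 u) w1 u.
  apply: partial => // [|u gu]; first exact: type2_ge0.
  rewrite -expectation_compl //; apply: ub_le_sup; first exact: type2_bound.
  by exists (P u) => //; exact: G1.
have E : \sum_u (w1 u - w0 u) * expectation_under (P u) psi =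
    1 - \sum_u w1 u * (1 - e u) - \sum_u w0 u * e u.
  rewrite -[X in X - _ - _]w11 -!sumrB; apply: eq_bigr => u _; rewrite -/(e u); ring.
have := ler_norm (\sum_u (w1 u - w0 u) * expectation_under (P u) psi).
rewrite {1}E /test_risk; lra.
Qed.

Lemma minimax_risk_le rho psi : tests psi ->
  minimax_risk X1 X2 X3 n12 n23 n13 rho <= test_risk rho psi.
Proof.
move=> t; apply: ge_inf; last by exists psi.
by exists 0 => _ [phi tphi <-]; exact: test_risk_ge0.
Qed.

Lemma zero_test : tests (fun _ : smp => 0 : R).
Proof. by move=> z; rewrite lexx ler01. Qed.

End Samples.

Section Radius.
Variables n12 n23 n13 : nat.

Lemma radius_set_nonempty : ([set rho : R | 0 <= rho /\
   minimax_risk X1 X2 X3 n12 n23 n13 rho <= 2^-1] !=set0)%classic.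
Proof.
(* no family has incompatibility 2, so accepting always is a perfect test *)
exists 2; split => //.
apply: le_trans (minimax_risk_le 2 (zero_test (n12 := n12))) _.
rewrite /test_risk.
have -> : @separated_dists R X1 X2 X3 2 = set0.
  apply/seteqP; split => // P [dP H].
  by have := incompatibility_le1 dP; lra.
rewrite image_set0 sup0 addr0.
apply: (@le_trans _ _ 0); last by rewrite invr_ge0.
case: (pselect ([set expectation_under P
   (fun _ : sample X1 X2 X3 n12 n23 n13 => 0 : R) |
   P in @compatible_dists R X1 X2 X3] !=set0)%classic) => [ne|].
  apply: ge_sup => // _ [P _ <-]; rewrite /expectation_under big1 // => z _.
  by rewrite mul0r.
by move=> /set0P/negP; rewrite negbK => /eqP ->; rewrite sup0.
Qed.

(** The constant 3/5 stands for any number above the level 1/2 that defines the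
    radius. *)
Lemma testing_radius_ge (x : R) :
  (forall rho (psi : sample X1 X2 X3 n12 n23 n13 -> R), 0 <= rho -> rho < x ->
     tests psi -> 3 / 5 <= test_risk rho psi) ->
  x <= testing_radius R X1 X2 X3 n12 n23 n13.
Proof.
move=> H; apply: lb_le_inf; first exact: radius_set_nonempty.
move=> rho [rho0]; rewrite leNgt => /negP Hrisk; rewrite leNgt; apply/negP => rx.
apply: Hrisk; apply: (@lt_le_trans _ _ (3 / 5)); first by lra.
apply: lb_le_inf.
  pose psi0 (_ : sample X1 X2 X3 n12 n23 n13) : R := 0.
  by exists (test_risk rho psi0), psi0 => //; exact: zero_test.
by move=> _ [psi t <-]; exact: H.
Qed.

End Radius.

End Risk.

(** * Reduction to one of the three samples *)

Section Slots.
Context {R : realType} {X1 X2 X3 : finType} {n12 n23 n13 : nat}.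
Implicit Types (psi : sample X1 X2 X3 n12 n23 n13 -> R).

Lemma slot_weight_le1 (A B : finType) (nA nB : nat) (pA : A -> R) (pB : B -> R)
    (phi : {ffun 'I_nA -> A} -> {ffun 'I_nB -> B} -> R) :
  is_dist pA -> is_dist pB -> (forall a b, 0 <= phi a b <= 1) ->
  `|\sum_a \sum_b phi a b * ((\prod_i pA (a i)) * (\prod_i pB (b i)))| <= 1.
Proof.
move=> [A0 A1] [B0 B1] p01.
have W0 (a : {ffun 'I_nA -> A}) (b : {ffun 'I_nB -> B}) :
   0 <= (\prod_i pA (a i)) * (\prod_i pB (b i)) by rewrite mulr_ge0 ?prodr_ge0.
rewrite ger0_norm; last first.
  apply: sumr_ge0 => a _; apply: sumr_ge0 => b _; rewrite mulr_ge0 //.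
  by case/andP: (p01 a b).
apply: (@le_trans _ _ (\sum_(a : {ffun 'I_nA -> A}) \sum_(b : {ffun 'I_nB -> B})
   (\prod_i pA (a i)) * (\prod_i pB (b i)))).
  apply: ler_sum => a _; apply: ler_sum => b _; rewrite ler_piMl //.
  by case/andP: (p01 a b).
under eq_bigr do rewrite -mulr_sumr sum_iid_eq1 // mulr1.
by rewrite sum_iid_eq1.
Qed.

(** Averaging a test over the two samples whose laws are fixed leaves a bounded
    function of the third one. *)
Lemma exists_slot12 (p23 : X2 * X3 -> R) (p13 : X1 * X3 -> R) psi :
  is_dist p23 -> is_dist p13 -> tests psi ->
  exists h : {ffun 'I_n12 -> X1 * X2} -> R, (forall z, `|h z| <= 1) /\
    forall p12, expectation_under (Family p12 p23 p13) psi =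
      \sum_z h z * \prod_l p12 (z l).
Proof.
move=> d23 d13 t.
exists (fun z => \sum_a \sum_b psi (z, a, b) *
   ((\prod_i p23 (a i)) * (\prod_i p13 (b i)))); split => [z|p12].
  exact: slot_weight_le1.
rewrite expectationE; apply: eq_bigr => z _ /=.
rewrite mulr_suml; apply: eq_bigr => a _; rewrite mulr_suml.
by apply: eq_bigr => b _; ring.
Qed.

Lemma exists_slot23 (p12 : X1 * X2 -> R) (p13 : X1 * X3 -> R) psi :
  is_dist p12 -> is_dist p13 -> tests psi ->
  exists h : {ffun 'I_n23 -> X2 * X3} -> R, (forall z, `|h z| <= 1) /\
    forall p23, expectation_under (Family p12 p23 p13) psi =
      \sum_z h z * \prod_l p23 (z l).
Proof.
move=> d12 d13 t.
exists (fun z => \sum_a \sum_b psi (a, z, b) *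
   ((\prod_i p12 (a i)) * (\prod_i p13 (b i)))); split => [z|p23].
  exact: slot_weight_le1 (fun a b => psi (a, z, b)) _ _ _.
rewrite expectationE exchange_big; apply: eq_bigr => z _ /=.
rewrite mulr_suml; apply: eq_bigr => a _; rewrite mulr_suml.
by apply: eq_bigr => b _; ring.
Qed.

End Slots.

(** * Exchanging the two binary coordinates *)

Section Swap.
Context {R : realType}.

Definition swap_family {X1 X2 X3 : finType} (P : Defs.family R X1 X2 X3) :
    Defs.family R X1 X3 X2 :=
  Family (at13 P) (fun u => at23 P (u.2, u.1)) (at12 P).

Definition swap_sample {X1 X2 X3 : finType} {n12 n23 n13 : nat}
    (z : sample X1 X2 X3 n12 n23 n13) : sample X1 X3 X2 n13 n23 n12 :=
  (z.2, [ffun i => ((z.1.2 i).2, (z.1.2 i).1)], z.1.1).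

Lemma swap_familyK (X1 X2 X3 : finType) :
  cancel (@swap_family X1 X2 X3) (@swap_family X1 X3 X2).
Proof.
case=> a b c; rewrite /swap_family /=; congr Family.
by apply: boolp.funext => -[].
Qed.

Lemma swap_sampleK (X1 X2 X3 : finType) (n12 n23 n13 : nat) :
  cancel (@swap_sample X1 X2 X3 n12 n23 n13) (@swap_sample X1 X3 X2 n13 n23 n12).
Proof.
case=> -[a b] c; rewrite /swap_sample /=; congr (_, _, _).
by apply/ffunP => i; rewrite !ffunE /=; case: (b i).
Qed.

Lemma sum_swap (A B : finType) (f : A * B -> R) :
  \sum_(u : B * A) f (u.2, u.1) = \sum_u f u.
Proof.
by rewrite (reindex (fun u : B * A => (u.2, u.1))) //; exists (fun u => (u.2, u.1)) => -[].
Qed.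

Lemma is_dist_swap (A B : finType) (p : A * B -> R) :
  is_dist p -> is_dist (fun u : B * A => p (u.2, u.1)).
Proof. by move=> [p0 p1]; split => //; rewrite sum_swap. Qed.

Section OneDirection.
Variables (X1 X2 X3 : finType) (n12 n23 n13 : nat).
Implicit Types (P f : Defs.family R X1 X2 X3).

Lemma swap_dists P : dists P -> dists (swap_family P).
Proof. by move=> [? ? ?]; split => //=; exact: is_dist_swap. Qed.

Lemma swap_Gplus f : Gplus f -> Gplus (swap_family f).
Proof.
move=> [f12 f23 f13 H]; split => //= x1 x3 x2.
by have := H x1 x2 x3; lra.
Qed.

Lemma swap_dual_value f P :
  dual_value (swap_family f) (swap_family P) = dual_value f P.
Proof.
rewrite /dual_value /= (sum_swap (fun u => at23 f u * at23 P u)).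
by congr (- (_ * _)); ring.
Qed.

Lemma swap_compatible P : compatible_dists P -> compatible_dists (swap_family P).
Proof.
move=> [dP [p [[p0 p1] [m12 m23 m13]]]]; split; first exact: swap_dists.
exists (fun x => p (x.1.1, x.2, x.1.2)); split; last by split => /= *.
split => //; rewrite -[RHS]p1.
rewrite (reindex (fun x : X1 * X2 * X3 => (x.1.1, x.2, x.1.2))) /=.
  by apply: eq_bigr => -[[? ?] ?].
by exists (fun x => (x.1.1, x.2, x.1.2)) => -[[? ?] ?].
Qed.

Lemma swap_incompatibility_le P :
  dists P -> incompatibility P <= incompatibility (swap_family P).
Proof.
move=> dP; apply: ge_sup.
  by eexists; exists (Family (fun=> 0) (fun=> 0) (fun=> 0)) => //; exact: zero_Gplus.
move=> _ [f Gf <-]; rewrite -/(dual_value f P) -swap_dual_value.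
exact: dual_value_le_incompatibility (swap_Gplus Gf) (swap_dists dP).
Qed.

Lemma swap_separated rho P :
  separated_dists rho P -> separated_dists rho (swap_family P).
Proof.
move=> [dP H]; split; first exact: swap_dists.
exact: le_trans (swap_incompatibility_le dP).
Qed.

Lemma swap_expectation P (psi : sample X1 X2 X3 n12 n23 n13 -> R) :
  expectation_under (swap_family P) (psi \o swap_sample) = expectation_under P psi.
Proof.
rewrite /expectation_under [RHS](reindex (@swap_sample X1 X3 X2 n13 n23 n12)) /=.
  apply: eq_bigr => -[[a b] c] _ /=; congr (_ * _); rewrite /likelihood /=.
  under [X in _ = _ * X * _]eq_bigr do rewrite ffunE.
  by ring.
exists (@swap_sample X1 X2 X3 n12 n23 n13) => z _; exact: swap_sampleK.
Qed.

End OneDirection.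

Lemma swap_expectation_set (X1 X2 X3 : finType) (n12 n23 n13 : nat)
    (A : forall X2 X3 : finType, set (Defs.family R X1 X2 X3))
    (psi : sample X1 X2 X3 n12 n23 n13 -> R) :
  (forall Y Z (P : Defs.family R X1 Y Z), A Y Z P -> A Z Y (swap_family P)) ->
  [set expectation_under P (psi \o swap_sample) | P in A X3 X2]%classic =
  [set expectation_under P psi | P in A X2 X3]%classic.
Proof.
move=> HA; apply/seteqP; split => _ [P AP <-].
  by exists (swap_family P); [exact: HA | rewrite -swap_expectation swap_familyK].
by exists (swap_family P); [exact: HA | rewrite swap_expectation].
Qed.

Lemma swap_test_risk (X1 X2 X3 : finType) (n12 n23 n13 : nat) rho
    (psi : sample X1 X2 X3 n12 n23 n13 -> R) :
  test_risk rho (psi \o swap_sample) = test_risk rho psi.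
Proof.
rewrite /test_risk; congr (sup _ + sup _).
  apply: (swap_expectation_set (A := @compatible_dists R X1)) => Y Z P.
  exact: swap_compatible.
apply: (swap_expectation_set (A := fun Y Z => @separated_dists R X1 Y Z rho)
  (fun z => 1 - psi z)) => Y Z P.
exact: swap_separated.
Qed.

Lemma swap_minimax_risk_le (X1 X2 X3 : finType) (n12 n23 n13 : nat) (rho : R) :
  minimax_risk X1 X3 X2 n13 n23 n12 rho <= minimax_risk X1 X2 X3 n12 n23 n13 rho.
Proof.
apply: lb_le_inf.
  pose psi0 (_ : sample X1 X2 X3 n12 n23 n13) : R := 0.
  by exists (test_risk rho psi0), psi0 => //; exact: zero_test.
move=> _ [psi t <-]; rewrite -swap_test_risk; apply: minimax_risk_le => z.
exact: t.
Qed.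

Lemma testing_radius_swap (X1 X2 X3 : finType) (n12 n23 n13 : nat) :
  testing_radius R X1 X3 X2 n13 n23 n12 = testing_radius R X1 X2 X3 n12 n23 n13.
Proof.
congr inf; apply/seteqP; split => rho /= [rho0 H]; split => //;
  exact: le_trans (swap_minimax_risk_le _ _ _ _ _ _ _) H.
Qed.

End Swap.

(** * The parametric rate *)

Section TwoPoints.
Context {R : realType}.

Lemma exprn_add1_le_expR (y : R) n : 0 <= y -> (1 + y) ^+ n <= expR (n%:R * y).
Proof.
move=> y0; rewrite mulrC expRM_natr; apply: lerXn2r; rewrite ?nnegrE ?expR_ge0 //.
  by rewrite addr_ge0.
exact: expR_ge1Dx.
Qed.

(** [mixture_difference_le] for two point masses, at 0 and at [a]: only the
    zeroth moments agree, and the bound is [(1 + a ^ 2) ^ n - 1]. *)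
Lemma two_point_difference_le n (T : finType) (Q phi : T -> R) (a : R)
    (h : {ffun 'I_n -> T} -> R) :
  is_dist Q -> \sum_y Q y * phi y = 0 -> \sum_y Q y * phi y ^+ 2 = 1 ->
  (forall z, `|h z| <= 1) -> n%:R * a ^+ 2 <= 9^-1 ->
  `|\sum_z h z * \prod_l (Q (z l) * (1 + a * phi (z l)))
    - \sum_z h z * \prod_l Q (z l)| <= 2 / 5.
Proof.
move=> [Q0 Q1] Qphi Qphi2 h1 na.
pose nu (k : bool) : R := if k then 1 else -1.
pose t (k : bool) : R := if k then a else 0.
have := mixture_difference_le nu t Q0 Q1 Qphi Qphi2 h1.
rewrite big_bool /= mul1r mulN1r.
under [X in (_ - X) ^+ 2]eq_bigr do under eq_bigr do rewrite mul0r addr0 mulr1.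
set d := _ - _ => H.
have {H} : d ^+ 2 <= (1 + a ^+ 2) ^+ n - 1.
  have nu0 : \sum_k nu k * t k ^+ 0 = 0.
    by rewrite big_bool /= !expr0 !mulr1 subrr.
  have nuS j : \sum_k nu k * t k ^+ j.+1 = a ^+ j.+1.
    by rewrite big_bool /= expr0n mulr0 addr0 mul1r.
  apply: le_trans H _; rewrite exprDn !big_ord_recl /= nu0 bin0 !expr0 !expr1n.
  rewrite expr0n /= !mulr0 add0r ?mulr1 ?mulr1n [leRHS]addrAC subrr add0r.
  apply: ler_sum => i _.
  by rewrite /bump /= nuS !expr1n !mulr1 mul1r -exprM mulnC exprM mulr_natl.
have E : (1 + a ^+ 2) ^+ n <= 9 / 8.
  apply: le_trans (exprn_add1_le_expR n (sqr_ge0 a)) _.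
  apply: (@le_trans _ _ (expR 9^-1)); first by rewrite ler_expR.
  have e0 := expR_gt0 (9^-1 : R).
  have := expR_ge1Dx (- 9^-1 : R); rewrite expRN.
  have : expR (9^-1 : R) * (expR 9^-1)^-1 = 1 by rewrite divff // gt_eqF.
  by nra.
move=> dE; have two5 : 0 <= 2 / 5 :> R by lra.
rewrite -ler_sqr ?nnegrE //.
rewrite real_normK ?num_real //; lra.
Qed.

Lemma sum_pair (A B : finType) (f : A * B -> R) :
  \sum_u f u = \sum_x \sum_y f (x, y).
Proof. by rewrite pair_bigA; apply: eq_bigr => -[]. Qed.

Lemma sum_card2 (B : finType) (b0 : B) : #|B| = 2%N ->
  exists2 b1, b1 != b0 & forall f : B -> R, \sum_b f b = f b0 + f b1.
Proof.
move=> B2; have /card1P[b1 Hb1] : #|[pred b | b != b0]| == 1%N.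
  by have := cardC1 b0; rewrite B2 => ->.
exists b1; first by have := Hb1 b1; rewrite !inE eqxx => ->.
move=> f; rewrite (bigD1 b0) //=; congr (_ + _).
by rewrite (eq_bigl (pred1 b1)) ?big_pred1_eq.
Qed.

Definition sign_at (B : eqType) (b0 b : B) : R := if b == b0 then 1 else -1.

End TwoPoints.

Section Uniform.
Context {R : realType} {X1 X2 X3 : finType}.
Variables (b0 : X2) (c0 : X3).
Hypothesis X1_gt0 : (0 < #|X1|)%N.
Hypothesis X2_2 : #|X2| = 2%N.
Hypothesis X3_2 : #|X3| = 2%N.
Let r : R := #|X1|%:R.
Let r0 : 0 < r. Proof. by rewrite ltr0n. Qed.
Notation sg := (@sign_at R X2 b0).

Lemma sum_card2_sign_at : exists2 b1, b1 != b0 &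
  (forall f : X2 -> R, \sum_b f b = f b0 + f b1) /\ sg b0 = 1 /\ sg b1 = -1.
Proof.
have [b1 b10 H] := @sum_card2 R X2 b0 X2_2.
by exists b1 => //; split => //; rewrite /sign_at eqxx (negbTE b10).
Qed.

Definition uniform12 (u : X1 * X2) : R := (2 * r)^-1.
Definition uniform23 (u : X2 * X3) : R := 4^-1.
Definition uniform13 (u : X1 * X3) : R := (2 * r)^-1.

Lemma sum_const_X1 (x : R) : \sum_(i : X1) x = r * x.
Proof. by rewrite sumr_const -[LHS]mulr_natl. Qed.

Lemma tilted12_dist (a : R) : `|a| <= 1 ->
  is_dist (fun u => uniform12 u * (1 + a * sg u.2)).
Proof.
move=> /ler_normlP[aN a1]; split => [u|].
  apply: mulr_ge0; first by rewrite invr_ge0 mulr_ge0 // ltW.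
  by rewrite /sign_at; case: ifP => _; lra.
rewrite sum_pair; have [b1 _ [S [s0 s1]]] := sum_card2_sign_at.
under eq_bigr do rewrite S /= s0 s1 /uniform12.
by rewrite sum_const_X1 /uniform12; field; rewrite gt_eqF.
Qed.

Lemma tilted23_dist (a : R) : `|a| <= 1 ->
  is_dist (fun u => uniform23 u * (1 + a * sg u.1)).
Proof.
move=> /ler_normlP[aN a1]; split => [u|].
  apply: mulr_ge0; first by rewrite invr_ge0.
  by rewrite /sign_at; case: ifP => _; lra.
have [c1 _ Sc] := @sum_card2 R X3 c0 X3_2.
rewrite sum_pair; have [b1 _ [S [s0 s1]]] := sum_card2_sign_at.
by rewrite S !Sc /= s0 s1 /uniform23; field.
Qed.

Lemma uniform12_dist : is_dist uniform12.
Proof.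
have := @tilted12_dist 0; rewrite normr0 ler01 => /(_ isT)[h0 h1].
split; first by move=> u; have := h0 u; rewrite mul0r addr0 mulr1.
by rewrite -h1; apply: eq_bigr => u _; rewrite mul0r addr0 mulr1.
Qed.

Lemma uniform23_dist : is_dist uniform23.
Proof.
have := @tilted23_dist 0; rewrite normr0 ler01 => /(_ isT)[h0 h1].
split; first by move=> u; have := h0 u; rewrite mul0r addr0 mulr1.
by rewrite -h1; apply: eq_bigr => u _; rewrite mul0r addr0 mulr1.
Qed.

Lemma uniform13_dist : is_dist uniform13.
Proof.
split=> [u|]; first by rewrite invr_ge0 mulr_ge0 // ltW.
have [c1 _ Sc] := @sum_card2 R X3 c0 X3_2.
rewrite sum_pair; under eq_bigr do rewrite Sc /uniform13.
by rewrite sum_const_X1 /uniform13; field; rewrite gt_eqF.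
Qed.

Lemma uniform_compatible :
  compatible_dists (Family uniform12 uniform23 uniform13).
Proof.
have [c1 _ Sc] := @sum_card2 R X3 c0 X3_2.
have [b1 _ Sb] := @sum_card2 R X2 b0 X2_2.
split; first by split; [exact: uniform12_dist|exact: uniform23_dist|exact: uniform13_dist].
exists (fun=> (4 * r)^-1); split; split => /=.
- by move=> _; rewrite invr_ge0 mulr_ge0 // ltW.
- rewrite !sum_pair; under eq_bigr do rewrite Sb !Sc.
  by rewrite sum_const_X1; field; rewrite gt_eqF.
- by move=> x b; rewrite Sc /uniform12; field; rewrite gt_eqF.
- by move=> b c; rewrite sum_const_X1 /uniform23; field; rewrite gt_eqF.
- by move=> x c; rewrite Sb /uniform13; field; rewrite gt_eqF.
Qed.

(** Families whose [X2]-marginals differ are detected by the indicator of [b0],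
    taken with opposite signs on the two patterns that contain coordinate 2;
    the sign [e] selects the larger marginal. *)
Lemma marginal_mismatch_incompatibility (e : R) (P : Defs.family R X1 X2 X3) :
  `|e| = 1 -> dists P ->
  e * (\sum_u (u.2 == b0)%:R * at12 P u - \sum_u (u.1 == b0)%:R * at23 P u) / 3
  <= incompatibility P.
Proof.
move=> e1 dP.
have eI (x : bool) : -1 <= e * x%:R.
  have := lexx `|e|; rewrite {2}e1 => /ler_normlP[h1 h2].
  by case: x; rewrite /= ?mulr1 ?mulr0; lra.
have eI' (x : bool) : -1 <= - e * x%:R.
  have := lexx `|e|; rewrite {2}e1 => /ler_normlP[h1 h2].
  by case: x; rewrite /= ?mulr1 ?mulr0; lra.
pose f : Defs.family R X1 X2 X3 := Family (fun u => - e * (u.2 == b0)%:R)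
  (fun u => e * (u.1 == b0)%:R) (fun=> 0).
have Gf : Gplus f.
  by split => //= x1 x2 x3; rewrite mulNr addNr addr0.
apply: le_trans (dual_value_le_incompatibility Gf dP); rewrite /dual_value /=.
under [X in _ <= - (_ * (X + _ + _))]eq_bigr do rewrite -mulrA.
under [X in _ <= - (_ * (_ + X + _))]eq_bigr do rewrite -mulrA.
under [X in _ <= - (_ * (_ + _ + X))]eq_bigr do rewrite mul0r.
by rewrite sumr_const mul0rn -!mulr_sumr; lra.
Qed.

Lemma two_point_risk n12 n23 n13 (P0 P1 : Defs.family R X1 X2 X3) (rho : R)
    (psi : sample X1 X2 X3 n12 n23 n13 -> R) :
  compatible_dists P0 -> separated_dists rho P1 -> tests psi ->
  1 - `|expectation_under P1 psi - expectation_under P0 psi| <= test_risk rho psi.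
Proof.
move=> C0 S1 t.
pose w (v u : bool) : R := (u == v)%:R.
have wd v : is_dist (w v).
  by split => [u|]; [exact: ler0n | rewrite big_bool /w; case: v; rewrite /= ?addr0 ?add0r].
have := @test_risk_ge_mixtures R X1 X2 X3 n12 n23 n13 bool
  (fun u => if u then P1 else P0) (w false) (w true) negb id rho psi.
rewrite big_bool /w /= subr0 sub0r mul1r mulN1r => H.
apply: le_trans (H _ (wd false) (wd true) _ _ t).
- by rewrite !big1 ?subr0 //; case.
- by case; [case: S1 | case: C0].
- by case.
- by case.
Qed.

Lemma radius_ge_parametric12 n12 n23 n13 : (0 < n12)%N ->
  1 / (18 * Num.sqrt (n12%:R : R)) <= testing_radius R X1 X2 X3 n12 n23 n13.
Proof.
move=> n0; set q := Num.sqrt _.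
have q0 : 0 < q by rewrite sqrtr_gt0 ltr0n.
have q2 : q ^+ 2 = n12%:R by rewrite sqr_sqrtr // ler0n.
have q1 : 1 <= q by rewrite -sqrtr1 ler_sqrt ?ler0n // ler1n.
apply: testing_radius_ge => rho psi rho0 rho_lt t.
(* so that [n a ^ 2 = 1 / 9] *)
pose a := (3 * q)^-1.
have a0 : 0 < a by rewrite invr_gt0 mulr_gt0.
have a1 : `|a| <= 1 by rewrite gtr0_norm // invf_le1 ?mulr_gt0 //; lra.
pose P1 := Family (fun u => uniform12 u * (1 + a * sg u.2)) uniform23 uniform13.
have d1 : dists P1.
  by split; [exact: tilted12_dist|exact: uniform23_dist|exact: uniform13_dist].
have [c1 _ Sc] := @sum_card2 R X3 c0 X3_2.
have [b1 b10 [Sb [s0 s1]]] := sum_card2_sign_at.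
have sep : separated_dists rho P1.
  split=> //; apply: le_trans (@marginal_mismatch_incompatibility 1 P1 (normr1 _) d1).
  apply: le_trans (ltW rho_lt) _; rewrite /= !sum_pair.
  under eq_bigr do rewrite Sb /= eqxx (negbTE b10) s0 s1 /uniform12.
  rewrite sum_const_X1 Sb !Sc /= eqxx (negbTE b10) /uniform12 /uniform23 /=.
  rewrite le_eqVlt; apply/orP; left; apply/eqP; rewrite /a.
  by field; rewrite !gt_eqF.
apply: le_trans (two_point_risk uniform_compatible sep t).
have [h [h1 E]] := exists_slot12 uniform23_dist uniform13_dist t.
rewrite !E /=.
have : n12%:R * a ^+ 2 <= 9^-1.
  rewrite -q2 /a le_eqVlt; apply/orP; left; apply/eqP.
  by field; rewrite gt_eqF.
move/(two_point_difference_le uniform12_dist _ _ h1 (phi := fun u => sg u.2)) => H.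
suff : 1 - 2 / 5 <= 1 - `|\sum_z h z * \prod_l (uniform12 (z l) * (1 + a * sg (z l).2))
  - \sum_z h z * \prod_l uniform12 (z l)| by move=> ?; lra.
rewrite lerD2l lerN2; apply: H.
  rewrite sum_pair; under eq_bigr do rewrite Sb /= s0 s1 /uniform12.
  by rewrite sum_const_X1 /uniform12; field; rewrite gt_eqF.
rewrite sum_pair; under eq_bigr do rewrite Sb /= s0 s1 /uniform12.
by rewrite sum_const_X1 /uniform12; field; rewrite gt_eqF.
Qed.

Lemma radius_ge_parametric23 n12 n23 n13 : (0 < n23)%N ->
  1 / (18 * Num.sqrt (n23%:R : R)) <= testing_radius R X1 X2 X3 n12 n23 n13.
Proof.
move=> n0; set q := Num.sqrt _.
have q0 : 0 < q by rewrite sqrtr_gt0 ltr0n.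
have q2 : q ^+ 2 = n23%:R by rewrite sqr_sqrtr // ler0n.
have q1 : 1 <= q by rewrite -sqrtr1 ler_sqrt ?ler0n // ler1n.
apply: testing_radius_ge => rho psi rho0 rho_lt t.
(* so that [n a ^ 2 = 1 / 9] *)
pose a := (3 * q)^-1.
have a0 : 0 < a by rewrite invr_gt0 mulr_gt0.
have a1 : `|a| <= 1 by rewrite gtr0_norm // invf_le1 ?mulr_gt0 //; lra.
pose P1 := Family uniform12 (fun u => uniform23 u * (1 + a * sg u.1)) uniform13.
have d1 : dists P1.
  by split; [exact: uniform12_dist|exact: tilted23_dist|exact: uniform13_dist].
have [c1 _ Sc] := @sum_card2 R X3 c0 X3_2.
have [b1 b10 [Sb [s0 s1]]] := sum_card2_sign_at.
have sep : separated_dists rho P1.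
  split=> //.
  apply: le_trans (@marginal_mismatch_incompatibility (-1) P1 (normrN1 _) d1).
  apply: le_trans (ltW rho_lt) _; rewrite /= !sum_pair.
  under eq_bigr do rewrite Sb /= eqxx (negbTE b10) /uniform12.
  rewrite sum_const_X1 Sb !Sc /= eqxx (negbTE b10) s0 s1 /uniform12 /uniform23 /=.
  rewrite le_eqVlt; apply/orP; left; apply/eqP; rewrite /a.
  by field; rewrite !gt_eqF.
apply: le_trans (two_point_risk uniform_compatible sep t).
have [h [h1 E]] := exists_slot23 uniform12_dist uniform13_dist t.
rewrite !E /=.
have : n23%:R * a ^+ 2 <= 9^-1.
  rewrite -q2 /a le_eqVlt; apply/orP; left; apply/eqP.
  by field; rewrite gt_eqF.
move/(two_point_difference_le uniform23_dist _ _ h1 (phi := fun u => sg u.1)) => H.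
suff : 1 - 2 / 5 <= 1 - `|\sum_z h z * \prod_l (uniform23 (z l) * (1 + a * sg (z l).1))
  - \sum_z h z * \prod_l uniform23 (z l)| by move=> ?; lra.
rewrite lerD2l lerN2; apply: H.
  by rewrite sum_pair Sb !Sc /= s0 s1 /uniform23; field.
by rewrite sum_pair Sb !Sc /= s0 s1 /uniform23; field.
Qed.

End Uniform.

(** * Families whose compatibility is governed by a mean modulus *)

Section ModulusFamilies.
Context {R : realType} {X1 X2 X3 : finType}.
Variables (b0 : X2) (c0 : X3).
Hypothesis X1_gt0 : (0 < #|X1|)%N.
Hypothesis X2_2 : #|X2| = 2%N.
Hypothesis X3_2 : #|X3| = 2%N.
Let r : R := #|X1|%:R.
Let r0 : 0 < r. Proof. by rewrite ltr0n. Qed.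
Let rN0 : r != 0. Proof. by rewrite gt_eqF. Qed.
Notation sg := (@sign_at R X2 b0).

Definition tilt (eta : X1 -> R) (u : X1 * X2) : R :=
  (2 * r)^-1 * (1 + sg u.2 * eta u.1).

Definition coupled23 (tau : R) (u : X2 * X3) : R :=
  (if (u.1 == b0) == (u.2 == c0) then 1 - tau else tau) / 2.

Definition modulus_family (eta : X1 -> R) (tau : R) : Defs.family R X1 X2 X3 :=
  Family (tilt eta) (coupled23 tau) (@uniform13 R X1 X3).

Lemma norm_sign_at b : `|sg b| = 1.
Proof. by rewrite /sign_at; case: ifP; rewrite ?normrN normr1. Qed.

Lemma tilt_dist (eta : X1 -> R) : (forall x, `|eta x| <= 1) -> is_dist (tilt eta).
Proof.
move=> e1; split => [[x b]|].
  apply: mulr_ge0; first by rewrite invr_ge0 mulr_ge0 // ltW.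
  have : `|sg b * eta x| <= 1 by rewrite normrM norm_sign_at mul1r.
  by move=> /ler_normlP[]; lra.
rewrite sum_pair; have [b1 _ [S [s0 s1]]] := @sum_card2_sign_at R X2 b0 X2_2.
rewrite (eq_bigr (fun=> r^-1)).
  by rewrite sum_const_X1 mulfV.
by move=> x _; rewrite S /tilt /= s0 s1; field.
Qed.

Lemma coupled23_dist tau : 0 <= tau <= 1 -> is_dist (coupled23 tau).
Proof.
move=> /andP[t0 t1]; split => [u|].
  by rewrite /coupled23; case: ifP => _; apply: divr_ge0 => //; lra.
rewrite sum_pair; have [b1 b10 Sb] := @sum_card2 R X2 b0 X2_2.
have [c1 c10 Sc] := @sum_card2 R X3 c0 X3_2.
rewrite Sb !Sc /coupled23 /= !eqxx (negbTE b10) (negbTE c10) /=; lra.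
Qed.

Lemma modulus_family_dists eta tau :
  (forall x, `|eta x| <= 1) -> 0 <= tau <= 1 -> dists (modulus_family eta tau).
Proof.
move=> e1 t01; split; [exact: tilt_dist | exact: coupled23_dist|].
exact: uniform13_dist.
Qed.

(** The three margins determine a joint law up to the mass of
    [(b0, c0)] given [x]; the extremal coupling puts [min (1 + eta x) 1] there
    (over [2 r]), and lowering it uniformly by [kappa] reaches the prescribed
    [P_{23}]. *)
Lemma modulus_family_compatible (eta : X1 -> R) (S tau : R) :
  (forall x, `|eta x| <= 2^-1) -> \sum_x eta x = 0 -> \sum_x `|eta x| = 2 * S ->
  S / r <= tau -> 0 <= tau <= 4^-1 -> compatible_dists (modulus_family eta tau).
Proof.
move=> e1 eta0 etaS St /andP[t0 t1].
have dP : dists (modulus_family eta tau).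
  apply: modulus_family_dists; last by apply/andP; split; lra.
  by move=> x; apply: le_trans (e1 x) _; lra.
have S0 : 0 <= S / r.
  apply: divr_ge0; last exact: ltW.
  have : 0 <= \sum_x `|eta x| by apply: sumr_ge0.
  rewrite etaS; lra.
split => //.
pose kappa := tau - S / r.
pose p (v : X1 * X2 * X3) : R := (2 * r)^-1 *
  (if (v.1.2 == b0) == (v.2 == c0)
   then 1 - (`|eta v.1.1| - sg v.1.2 * eta v.1.1) / 2 - kappa
   else (`|eta v.1.1| + sg v.1.2 * eta v.1.1) / 2 + kappa).
have [b1 b10 [Sb [s0 s1]]] := @sum_card2_sign_at R X2 b0 X2_2.
have [c1 c10 Sc] := @sum_card2 R X3 c0 X3_2.
have Tb b : b = b0 \/ b = b1.
  have := Sb (fun b' => (b' == b)%:R).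
  rewrite (bigD1 b) //= eqxx big1 => [|b' /negbTE -> //].
  case: (b0 =P b) => [->|_]; first by left.
  by case: (b1 =P b) => [->|_]; [right | move=> /eqP; rewrite !addr0 oner_eq0].
have Tc c : c = c0 \/ c = c1.
  have := Sc (fun c' => (c' == c)%:R).
  rewrite (bigD1 c) //= eqxx big1 => [|c' /negbTE -> //].
  case: (c0 =P c) => [->|_]; first by left.
  by case: (c1 =P c) => [->|_]; [right | move=> /eqP; rewrite !addr0 oner_eq0].
have m12 x1 x2 : tilt eta (x1, x2) = \sum_x3 p (x1, x2, x3).
  rewrite Sc /p /tilt /= eqxx (negbTE c10).
  by case: (x2 == b0) => /=; field.
have m13 x1 x3 : @uniform13 R X1 X3 (x1, x3) = \sum_x2 p (x1, x2, x3).
  rewrite Sb /p /uniform13 /= eqxx (negbTE b10) s0 s1.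
  by case: (x3 == c0) => /=; field.
have m23 x2 x3 : coupled23 tau (x2, x3) = \sum_x1 p (x1, x2, x3).
  rewrite -mulr_sumr /= /coupled23 /=.
  case: ifP => _.
    rewrite 2!sumrB -mulr_suml sumrB -mulr_sumr eta0 etaS !sum_const_X1 /kappa -/r.
    by field.
  rewrite big_split -mulr_suml big_split -mulr_sumr /= eta0 etaS sum_const_X1 /kappa -/r.
  by field.
exists p; split => //; split; last first.
  case: dP => -[_ d1] _ _; rewrite -[RHS]d1 !sum_pair.
  by apply: eq_bigr => x1 _; apply: eq_bigr => x2 _; rewrite -m12.
move=> [[x1 x2] x3]; rewrite /p /=; apply: mulr_ge0.
  by rewrite invr_ge0 mulr_ge0 // ltW.
have h : `|sg x2 * eta x1| = `|eta x1| by rewrite normrM norm_sign_at mul1r.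
have := e1 x1; rewrite -h; set y := sg x2 * _ => y1.
have := lexx `|y|; move/ler_normlP => [y2 y3].
have k0 : 0 <= kappa by rewrite subr_ge0.
have k1 : kappa <= tau by rewrite /kappa; lra.
by case: ifP => _; lra.
Qed.

(** The certificate is the inequality
    [1{x2 = b0, x3 = c0} <= 1{x1 \in A, x2 = b0} + 1{x1 \notin A, x3 = c0}]
    with [A] the set where [eta] is negative. *)
Lemma modulus_family_incompatibility (eta : X1 -> R) (S tau : R) :
  dists (modulus_family eta tau) ->
  \sum_x eta x = 0 -> \sum_x `|eta x| = 2 * S ->
  (S / r - tau) / 6 <= incompatibility (modulus_family eta tau).
Proof.
move=> dP eta0 etaS.
have [b1 b10 [Sb [s0 s1]]] := @sum_card2_sign_at R X2 b0 X2_2.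
have [c1 c10 Sc] := @sum_card2 R X3 c0 X3_2.
pose f : Defs.family R X1 X2 X3 := Family
  (fun u => ((eta u.1 < 0) && (u.2 == b0))%:R)
  (fun u => - ((u.1 == b0) && (u.2 == c0))%:R)
  (fun u => (~~ (eta u.1 < 0) && (u.2 == c0))%:R).
have Gf : Gplus f.
  split => /= [u|u|u|x1 x2 x3].
  - by apply: le_trans (ler0n _ _); rewrite lerN10.
  - by rewrite lerN2 lern1 leq_b1.
  - by apply: le_trans (ler0n _ _); rewrite lerN10.
  - by case: (eta x1 < 0); case: (x2 == b0); case: (x3 == c0) => /=; lra.
apply: le_trans (dual_value_le_incompatibility Gf dP); rewrite /dual_value /=.
rewrite (sum_pair (fun u => - _ * _)) Sb !Sc /= !eqxx (negbTE b10) (negbTE c10) /=.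
rewrite /coupled23 /= !eqxx /=.
rewrite addrAC !sum_pair -big_split /=.
rewrite [X in _ <= - (_ * (X + _))](_ : _ = 2^-1 - S / (2 * r)).
  rewrite le_eqVlt; apply/orP; left; apply/eqP; field; exact: rN0.
transitivity (\sum_x ((2 * r)^-1 * (1 + (eta x - `|eta x|) / 2))).
  apply: eq_bigr => x _; rewrite Sb Sc /= !eqxx (negbTE b10) (negbTE c10).
  rewrite /tilt /uniform13 /= s0 -/r.
  case: ltP => h /=; first by rewrite ltr0_norm //; field.
  by rewrite ger0_norm //; field.
rewrite -mulr_sumr big_split /= sum_const_X1 -mulr_suml sumrB eta0 etaS -/r.
by field.
Qed.

End ModulusFamilies.

(** * Opposite perturbations on pairs of points *)

Section Pairs.
Context {R : realType} {X : finType}.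
Notation m := (#|X|./2).

(** The value [v i] is used with opposite signs at the points of rank [2 i] and
    [2 i + 1], so that the sum over [X] vanishes exactly; a last unpaired point
    receives [0]. *)
Definition paired (v : 'I_m -> R) (x : X) : R :=
  if insub (enum_rank x)./2 is Some i then (-1) ^+ (enum_rank x) * v i else 0.

Lemma sum_paired (F : R -> R) (v : 'I_m -> R) : F 0 = 0 ->
  \sum_x F (paired v x) = \sum_i (F (v i) + F (- v i)).
Proof.
move=> F0.
pose f (j : nat) : R :=
  F (if insub j./2 is Some i then (-1) ^+ j * v i else 0).
have two k : \sum_(j < k.*2) f j = \sum_(i < k) (f i.*2 + f i.*2.+1).
  elim: k => [|k IH]; first by rewrite !big_ord0.
  by rewrite doubleS !big_ord_recr /= IH addrA.
have -> : \sum_x F (paired v x) = \sum_(j < #|X|) f j.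
  by rewrite [RHS](reindex (@enum_rank X)) //; exact: onW_bij (@enum_rank_bij X).
have last : f m.*2 = 0 by rewrite /f doubleK insubF ?ltnn.
have -> : \sum_(j < #|X|) f j = \sum_(j < m.*2) f j.
  rewrite -(big_mkord xpredT f) -(big_mkord xpredT f).
  rewrite -[in LHS](odd_double_half #|X|).
  by case: (odd #|X|) => //=; rewrite add1n big_nat_recr //= last addr0.
rewrite two; apply: eq_bigr => i _.
have -> : f i.*2 = F (v i).
  rewrite /f doubleK insubT => [|H]; first exact: ltn_ord.
  rewrite -signr_odd odd_double expr0 mul1r; congr (F (v _)).
  exact: val_inj.
have -> : f i.*2.+1 = F (- v i) => //.
rewrite /f /= uphalf_double insubT => [|H]; first exact: ltn_ord.
rewrite -signr_odd /= odd_double expr1 mulN1r; congr (F (- v _)).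
exact: val_inj.
Qed.

Lemma paired_le (v : 'I_m -> R) (c : R) : 0 <= c ->
  (forall i, `|v i| <= c) -> forall x, `|paired v x| <= c.
Proof.
move=> c0 vc x; rewrite /paired; case: insub => [i|]; last by rewrite normr0.
by rewrite normrM normrX normrN normr1 expr1n mul1r.
Qed.

Lemma sum_paired0 (v : 'I_m -> R) : \sum_x paired v x = 0.
Proof.
by rewrite (@sum_paired id) // big1 // => i _; rewrite /= addrN.
Qed.

Lemma sum_norm_paired (v : 'I_m -> R) :
  \sum_x `|paired v x| = 2 * \sum_i `|v i|.
Proof.
rewrite (@sum_paired Num.norm) ?normr0 // mulr_sumr.
by apply: eq_bigr => i _; rewrite normrN mulr_natl mulr2n.
Qed.

End Pairs.

Section Tail.
Context {R : realType}.

(** Chernoff's bound: multiplying the [j]-th term by [expR 3 ^+ (j - 2 D)]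
    restores a full binomial sum. *)
Lemma binomial_tail_le (n D : nat) (y : R) (c : nat -> R) :
  0 <= y -> n%:R * (y * expR 3) <= D%:R ->
  (forall j, (j < 2 * D)%N -> c j = 0) -> (forall j, 0 <= c j <= 4) ->
  \sum_(j < n.+1) 'C(n, j)%:R * y ^+ j * c j <= (2 * expR (- (2 * D%:R))) ^+ 2.
Proof.
move=> y0 ny cz c4.
apply: (@le_trans _ _ (\sum_(j < n.+1) 4 * expR (- (6 * D%:R)) *
    ('C(n, j)%:R * (y * expR 3) ^+ j))).
  apply: ler_sum => j _; have [/cz ->|jD] := ltnP j (2 * D).
    rewrite mulr0 !mulr_ge0 ?expR_ge0 // exprn_ge0 // mulr_ge0 ?expR_ge0 //.
  have -> : 4 * expR (- (6 * D%:R)) * ('C(n, j)%:R * (y * expR 3) ^+ j) =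
     'C(n, j)%:R * y ^+ j * (4 * (expR (- (6 * D%:R)) * expR 3 ^+ j)).
    by rewrite exprMn; ring.
  apply: ler_wpM2l; first by rewrite mulr_ge0 ?exprn_ge0.
  case/andP: (c4 j) => _ c4j; apply: le_trans c4j _.
  rewrite ler_peMr // -expRM_natr -expRD -[leLHS]expR0 ler_expR.
  have : (2 * D)%:R <= j%:R :> R by rewrite ler_nat.
  rewrite natrM; lra.
rewrite -mulr_sumr.
have -> : \sum_(j < n.+1) 'C(n, j)%:R * (y * expR 3) ^+ j = (1 + y * expR 3) ^+ n.
  by rewrite exprDn; apply: eq_bigr => j _; rewrite expr1n mul1r mulr_natl.
apply: (@le_trans _ _ (4 * expR (- (6 * D%:R)) * expR D%:R)).
  apply: ler_wpM2l; first by rewrite mulr_ge0 ?expR_ge0.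
  apply: le_trans (exprn_add1_le_expR _ _) _; first by rewrite mulr_ge0 ?expR_ge0.
  by rewrite ler_expR.
rewrite exprMn -expRM_natr -mulrA -expRD.
have -> : 2 ^+ 2 = 4 :> R by ring.
apply: ler_wpM2l => //; rewrite ler_expR.
have : 0 <= D%:R :> R by rewrite ler0n.
lra.
Qed.

End Tail.

(** * The nonparametric rate *)

Section MainBound.
Context {R : realType} {X1 X2 X3 : finType}.
Variables (b0 : X2) (c0 : X3).
Hypothesis X1_ge2 : (1 < #|X1|)%N.
Hypothesis X2_2 : #|X2| = 2%N.
Hypothesis X3_2 : #|X3| = 2%N.
Let r : R := #|X1|%:R.
Notation m := (#|X1|./2).
Let X1_gt0 : (0 < #|X1|)%N. Proof. exact: ltnW. Qed.
Let r0 : 0 < r. Proof. by rewrite ltr0n. Qed.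
Let rN0 : r != 0. Proof. by rewrite gt_eqF. Qed.
Notation sg := (@sign_at R X2 b0).

Variables (K : finType) (t mu0 mu1 : K -> R) (D : nat) (a : R) (n : nat).
Hypothesis t_le1 : forall k, `|t k| <= 1.
Hypothesis mu0_dist : is_dist mu0.
Hypothesis mu1_dist : is_dist mu1.
Hypothesis moments : forall j, (j < 2 * D)%N -> \sum_k (mu1 k - mu0 k) * t k ^+ j = 0.
Hypothesis a_ge0 : 0 <= a.
Hypothesis a_le_half : a <= 2^-1.
Hypothesis a_small : n%:R * (2 / r * a ^+ 2 * expR 3) <= D%:R.

Definition perturbation (u : {ffun 'I_m -> K}) : X1 -> R :=
  paired (fun i => a * t (u i)).

Lemma perturbation_le u x : `|perturbation u x| <= 2^-1.
Proof.
apply: paired_le => [|i]; first by lra.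
rewrite normrM (ger0_norm a_ge0); apply: le_trans a_le_half.
by rewrite ler_piMr.
Qed.

Lemma moment_difference_le2 j : `|\sum_k (mu1 k - mu0 k) * t k ^+ j| <= 2.
Proof.
have [p0 q0] := mu0_dist; have [p1 q1] := mu1_dist.
apply: le_trans (ler_norm_sum _ _ _) _.
have -> : 2 = \sum_k (mu1 k + mu0 k) by rewrite big_split /= q0 q1; ring.
apply: ler_sum => k _; rewrite normrM -[leRHS]mulr1; apply: ler_pM => //.
  by apply: le_trans (ler_normB _ _) _; rewrite !ger0_norm.
by rewrite normrX exprn_ile1.
Qed.

(** Given the other coordinates, the sample has law [Q (1 + a t phi)] with
    [phi] supported by the [i]-th pair, which [Q] charges with mass [2 / r]. *)
Lemma one_pair_difference_le (h : {ffun 'I_n -> X1 * X2} -> R) i u :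
  (forall z, `|h z| <= 1) ->
  `|\sum_k (mu1 k - mu0 k) *
     \sum_z h z * \prod_l tilt b0 (perturbation (coord_update u i k)) (z l)|
  <= 2 * expR (- (2 * D%:R)).
Proof.
move=> h1.
pose v0 (i' : 'I_m) := if i' == i then 0 else a * t (u i').
pose e (i' : 'I_m) : R := (i' == i)%:R.
pose Q := tilt b0 (paired v0).
pose phi (y : X1 * X2) := sg y.2 * paired e y.1.
have [b1 b10 [Sb [s0 s1]]] := @sum_card2_sign_at R X2 b0 X2_2.
have v0e x : paired v0 x * paired e x = 0.
  rewrite /paired; case: insub => [i'|]; last by rewrite mul0r.
  by rewrite /v0 /e; case: eqP => _; rewrite !mulr0 // mul0r.
have factor k y : tilt b0 (perturbation (coord_update u i k)) y =
    Q y * (1 + a * t k * phi y).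
  have v0e' := v0e y.1; rewrite /Q /tilt /phi.
  have -> : perturbation (coord_update u i k) y.1 =
     paired v0 y.1 + a * t k * paired e y.1.
    rewrite /perturbation /paired; case: insub => [i'|]; last by rewrite mulr0 addr0.
    rewrite /v0 /e ffunE; case: eqP => _ /=; ring.
  transitivity ((2 * #|X1|%:R)^-1 * (1 + sg y.2 * (paired v0 y.1 + a * t k * paired e y.1)
     + sg y.2 ^+ 2 * (a * t k) * (paired v0 y.1 * paired e y.1))); last by ring.
  by rewrite v0e'; ring.
have Qd : is_dist Q.
  apply: tilt_dist => // x; apply: le_trans (_ : 2^-1 <= 1); last lra.
  apply: paired_le => [|i']; first lra.
  rewrite /v0; case: eqP => _; first by rewrite normr0; lra.
  rewrite normrM (ger0_norm a_ge0); apply: le_trans a_le_half.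
  by rewrite ler_piMr.
have Qphi : \sum_y Q y * phi y = 0.
  rewrite sum_pair big1 // => x _; rewrite Sb /Q /phi /tilt /= s0 s1.
  transitivity (2 * (2 * #|X1|%:R)^-1 * (paired v0 x * paired e x)); first by ring.
  by rewrite v0e mulr0.
have Qphi2 : \sum_y Q y * phi y ^+ 2 = 2 / r.
  rewrite sum_pair.
  transitivity (\sum_x r^-1 * (paired e x ^+ 2)).
    apply: eq_bigr => x _; rewrite Sb /Q /phi /tilt /= s0 s1 -/r.
    by field.
  rewrite -mulr_sumr (@sum_paired _ _ (fun z => z ^+ 2)) ?expr0n //.
  rewrite (bigD1 i) //= big1 => [|i' /negbTE ii'].
    by rewrite /e eqxx /= addr0; field.
  by rewrite /e ii' oppr0 expr0n addr0.
under eq_bigr do under eq_bigr do under eq_bigr do rewrite factor.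
rewrite -ler_sqr ?nnegrE ?mulr_ge0 ?expR_ge0 // real_normK ?num_real //.
case: Qd => Q0 Q1.
apply: le_trans (mixture_difference_le (fun k => mu1 k - mu0 k) _ Q0 Q1 Qphi Qphi2 h1) _.
pose c j := (\sum_k (mu1 k - mu0 k) * t k ^+ j) ^+ 2.
rewrite (eq_bigr (fun j : 'I_n.+1 => 'C(n, j)%:R * (2 / r * a ^+ 2) ^+ j * c j)).
  apply: binomial_tail_le => //.
  - by rewrite mulr_ge0 ?sqr_ge0 // divr_ge0 // ltW.
  - by move=> j jD; rewrite /c moments // expr0n.
  - move=> j; rewrite /c sqr_ge0 /= -real_normK ?num_real //.
    have -> : 4 = 2 ^+ 2 :> R by ring.
    by rewrite ler_sqr ?nnegrE // moment_difference_le2.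
move=> j _; rewrite /c [in RHS]exprMn.
have -> : \sum_k (mu1 k - mu0 k) * (a * t k) ^+ j =
    a ^+ j * \sum_k (mu1 k - mu0 k) * t k ^+ j.
  by rewrite mulr_sumr; apply: eq_bigr => k _; rewrite exprMn; ring.
rewrite [in LHS](exprMn 2) -!(exprM a) (mulnC j); ring.
Qed.

Lemma prior_difference_le (h : {ffun 'I_n -> X1 * X2} -> R) :
  (forall z, `|h z| <= 1) ->
  `|\sum_(u : {ffun 'I_m -> K}) (\prod_i mu1 (u i) - \prod_i mu0 (u i)) *
     \sum_z h z * \prod_l tilt b0 (perturbation u) (z l)|
  <= m%:R * (2 * expR (- (2 * D%:R))).
Proof.
move=> h1; have [p0 q0] := mu0_dist; have [p1 q1] := mu1_dist.
by apply: hybrid_le => // i u; exact: one_pair_difference_le.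
Qed.

Let E0 := \sum_k mu0 k * `|t k|.
Let E1 := \sum_k mu1 k * `|t k|.
Variable gamma : R.
Hypothesis gamma_gt0 : 0 < gamma.
Hypothesis gap : gamma <= E1 - E0.

Lemma mean_modulus_bounds (mu : K -> R) : is_dist mu ->
  0 <= \sum_k mu k * `|t k| <= 1.
Proof.
move=> dmu; under eq_bigr do rewrite mulrC; apply/andP; split.
  by apply: mean_ge.
exact: mean_le.
Qed.

Lemma modulus_deviation (mu : K -> R) (bad : pred {ffun 'I_m -> K}) (s : R) :
  is_dist mu -> 0 < s ->
  (forall u, bad u ->
    s <= `|\sum_i `|t (u i)| - m%:R * \sum_k mu k * `|t k| |) ->
  \sum_(u : {ffun 'I_m -> K} | bad u) \prod_i mu (u i) <= m%:R / s ^+ 2.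
Proof.
move=> dmu s0 Hbad; have /andP[e0 e1] := mean_modulus_bounds dmu.
set e := \sum_k _ in Hbad e0 e1; case: dmu => mu_ge0 mu_sum.
apply: (@iid_chebyshev R _ _ mu (fun k => `|t k| - e)) => //.
- under eq_bigr do rewrite mulrBr.
  by rewrite sumrB -mulr_suml mu_sum mul1r subrr.
- move=> k; apply/ler_normlP; have := t_le1 k; have := normr_ge0 (t k).
  by split; lra.
- move=> u /Hbad; rewrite sumrB sumr_const card_ord.
  by rewrite -[e *+ _]mulr_natl.
Qed.

Let tau := a * (m%:R * ((E0 + E1) / 2)) / r.

Lemma half_card_bounds : r / 3 <= m%:R <= r / 2.
Proof.
have h : #|X1|%:R = (odd #|X1|)%:R + 2 * m%:R :> R.
  by rewrite -[in LHS](odd_double_half #|X1|) natrD -muln2 natrM mulrC.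
have m1 : 1 <= m%:R :> R by rewrite ler1n half_gt0.
by rewrite /r h; apply/andP; split; case: (odd _) => /=; lra.
Qed.

(** Under the first prior [S u] concentrates below [m] times the midpoint of [E0]
    and [E1]; under the second it exceeds this threshold by [m * gamma / 4]. By
    Chebyshev's inequality the exceptional masses are at most [4] and [16] over
    [m * gamma ^ 2]. *)
Lemma radius_ge_modulus n23 n13 :
  m%:R * (2 * expR (- (2 * D%:R))) + 20 / (m%:R * gamma ^+ 2) <= 2 / 5 ->
  a * gamma / 72 <= testing_radius R X1 X2 X3 n n23 n13.
Proof.
move=> Hsmall; apply: testing_radius_ge => rho psi rho0 rho_lt tpsi.
have /andP[mr3 mr2] := half_card_bounds.
have m0 : 0 < m%:R :> R by rewrite ltr0n half_gt0.
have /andP[E00 E01] := mean_modulus_bounds mu0_dist.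
have /andP[E10 E11] := mean_modulus_bounds mu1_dist.
rewrite -/E0 in E00 E01; rewrite -/E1 in E10 E11.
pose S (u : {ffun 'I_m -> K}) := \sum_i `|t (u i)|.
have mgap : m%:R * gamma <= m%:R * (E1 - E0) by apply: ler_wpM2l => //; exact: ltW.
pose Ebar := (E0 + E1) / 2.
pose good0 u := S u <= m%:R * Ebar.
pose good1 u := m%:R * (Ebar + gamma / 4) <= S u.
have tauE : tau = a * (m%:R / r) * Ebar by rewrite /tau /Ebar; field.
have mr : m%:R / r <= 2^-1 by rewrite ler_pdivrMr //; lra.
have mr' : 3^-1 <= m%:R / r by rewrite ler_pdivlMr //; lra.
have mr0 : 0 <= m%:R / r by rewrite divr_ge0 // ltW.
have am : a * (m%:R / r) <= 4^-1.
  by rewrite (_ : 4^-1 = 2^-1 * 2^-1 :> R); [apply: ler_pM | field].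
have am0 : 0 <= a * (m%:R / r) by rewrite mulr_ge0.
have tau0 : 0 <= tau by rewrite tauE mulr_ge0 // /Ebar; lra.
have tau1 : tau <= 4^-1.
  rewrite tauE; apply: le_trans am; rewrite ler_piMr // /Ebar; lra.
pose P u := modulus_family b0 c0 (perturbation u) tau.
have sum0 u : \sum_x perturbation u x = 0 by exact: sum_paired0.
have sumS u : \sum_x `|perturbation u x| = 2 * (a * S u).
  rewrite sum_norm_paired; congr (2 * _); rewrite mulr_sumr; apply: eq_bigr => i _.
  by rewrite normrM ger0_norm.
have dP u : dists (P u).
  apply: modulus_family_dists => //; last by apply/andP; split; lra.
  by move=> x; apply: le_trans (perturbation_le u x) _; lra.
have [p0 q0] := mu0_dist; have [p1 q1] := mu1_dist.
have W (mu : K -> R) : is_dist mu ->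
    is_dist (fun u : {ffun 'I_m -> K} => \prod_i mu (u i)).
  move=> [mu_ge0 mu_sum]; split; last exact: sum_iid_eq1.
  by move=> u; apply: prodr_ge0.
have C0 u : good0 u -> compatible_dists (P u).
  rewrite /good0 => Su.
  apply: (modulus_family_compatible b0 c0 X1_gt0 X2_2 X3_2
    (perturbation_le u) (sum0 u) (sumS u)) => //.
    rewrite tauE -/r (_ : a * (m%:R / r) * Ebar = a * (m%:R * Ebar) / r); last by field.
    by rewrite ler_pM2r ?invr_gt0 //; apply: ler_wpM2l.
  by rewrite tau0.
have C1 u : good1 u -> separated_dists rho (P u).
  rewrite /good1 => Su; split => //.
  apply: le_trans (modulus_family_incompatibility X1_gt0 X2_2 X3_2
    (dP u) (sum0 u) (sumS u)).
  apply: le_trans (ltW rho_lt) _; rewrite -/r tauE.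
  have h : a * (m%:R / r) * (Ebar + gamma / 4) <= a * S u / r.
    rewrite ler_pdivlMr // -[leLHS]mulrA mulrC.
    have -> : (Ebar + gamma / 4) * r * (a * (m%:R / r)) = a * (m%:R * (Ebar + gamma / 4)).
      by field.
    exact: ler_wpM2l.
  have h2 : a * gamma * 3^-1 <= a * gamma * (m%:R / r).
    by apply: ler_wpM2l => //; rewrite mulr_ge0 // ltW.
  nra.
have bad0 : \sum_(u | ~~ good0 u) \prod_i mu0 (u i) <= 4 / (m%:R * gamma ^+ 2).
  apply: le_trans (modulus_deviation (s := m%:R * gamma / 2) mu0_dist _ _) _.
  - by rewrite divr_gt0 // mulr_gt0.
  - move=> u; rewrite /good0 -ltNge => Su; apply: le_trans (ler_norm _).
    rewrite -/E0 -/(S u); move: Su; rewrite /Ebar; lra.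
  - rewrite le_eqVlt; apply/orP; left; apply/eqP; field.
    by rewrite !gt_eqF.
have bad1 : \sum_(u | ~~ good1 u) \prod_i mu1 (u i) <= 16 / (m%:R * gamma ^+ 2).
  apply: le_trans (modulus_deviation (s := m%:R * gamma / 4) mu1_dist _ _) _.
  - by rewrite divr_gt0 // mulr_gt0.
  - move=> u; rewrite /good1 -ltNge => Su; rewrite distrC; apply: le_trans (ler_norm _).
    rewrite -/E1 -/(S u); move: Su; rewrite /Ebar; lra.
  - rewrite le_eqVlt; apply/orP; left; apply/eqP; field.
    by rewrite !gt_eqF.
apply: le_trans (test_risk_ge_mixtures dP (W _ mu0_dist) (W _ mu1_dist) C0 C1 tpsi).
have d23 : is_dist (coupled23 b0 c0 tau).
  by apply: coupled23_dist => //; apply/andP; split; lra.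
have [h [h1 Eh]] := exists_slot12 (n12 := n) d23 (uniform13_dist c0 X1_gt0 X3_2) tpsi.
have := prior_difference_le h1.
rewrite (eq_bigr (fun u : {ffun 'I_m -> K} => (\prod_i mu1 (u i) - \prod_i mu0 (u i)) *
   expectation_under (P u) psi)); last by move=> u _; rewrite Eh.
have e20 : 20 / (m%:R * gamma ^+ 2) = 4 / (m%:R * gamma ^+ 2) + 16 / (m%:R * gamma ^+ 2).
  by rewrite -mulrDl -natrD.
move: Hsmall; rewrite e20; lra.
Qed.

End MainBound.

Section Rates.
Context {R : realType}.

Lemma ln_le_id (x : R) : 0 < x -> ln x <= x.
Proof.
move=> x0; have -> : ln x = ln (1 + (x - 1)) by congr ln; ring.
by apply: le_trans (le_ln1Dx _) _; lra.
Qed.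

(** From [ln x = 4 * ln (x ^ (1/4)) <= 4 * x ^ (1/4)]. *)
Lemma sqr_ln_le_eventually (C : R) : 0 < C ->
  exists2 r0 : R, 0 < r0 & forall x, r0 <= x -> 1 <= ln x /\ C * ln x ^+ 2 <= x.
Proof.
move=> C0; exists (Num.max (expR 1) ((16 * C) ^+ 2)).
  by rewrite lt_max expR_gt0.
move=> x; rewrite ge_max => /andP[xe xC].
have x0 : 0 < x by apply: lt_le_trans xe; exact: expR_gt0.
have l1 : 1 <= ln x by rewrite -[leLHS]expRK ler_ln ?posrE ?expR_gt0.
split => //.
set z := Num.sqrt x; set y := Num.sqrt z.
have z0 : 0 < z by rewrite sqrtr_gt0.
have y0 : 0 < y by rewrite sqrtr_gt0.
have zx : z ^+ 2 = x by rewrite sqr_sqrtr // ltW.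
have yz : y ^+ 2 = z by rewrite sqr_sqrtr // ltW.
have lny : ln x = 4 * ln y.
  by rewrite -zx -yz -exprM lnXn // mulr_natl.
have Cz : 16 * C <= z.
  by rewrite -ler_sqr ?nnegrE ?zx // ?mulr_ge0 // ltW.
have l0 : 0 <= ln x by lra.
have ly : ln y <= y by exact: ln_le_id.
have : ln x ^+ 2 <= 16 * z.
  rewrite -yz; have -> : 16 * y ^+ 2 = (4 * y) ^+ 2 by ring.
  by rewrite ler_sqr ?nnegrE ?mulr_ge0 ?(ltW y0) // lny ler_pM2l.
move=> h; apply: (@le_trans _ _ (C * (16 * z))).
  by apply: ler_wpM2l => //; exact: ltW.
rewrite -zx; nra.
Qed.

(** The square of [expR (-2) / 2] is below [expR (-3) / 4], the loss incurred by
    the tail bound; 72 and 30 come from [radius_ge_modulus] and from the gap of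
    the two measures. *)
Definition rate_constant : R := expR (- 2) / 2 / 72 / 30.

Lemma rate_constant_gt0 : 0 < rate_constant.
Proof. by do 3 apply: divr_gt0 => //; exact: expR_gt0. Qed.

(** The degree [D] lies between [ln r] and [2 ln r]: large enough for
    [expR (- 2 D)] to beat the number of pairs, small enough to keep the gap
    [1 / (30 D)] of order [1 / ln r]. *)
Lemma radius_ge_nonparametric (X1 X2 X3 : finType) (n12 n23 n13 : nat) :
  #|X2| = 2%N -> #|X3| = 2%N -> (0 < n12)%N -> (1 < #|X1|)%N ->
  5 <= #|X1|%:R :> R -> 1 <= ln (#|X1|%:R : R) ->
  20 * 30 ^+ 2 * 60 * ln (#|X1|%:R : R) ^+ 2 <= #|X1|%:R ->
  rate_constant * Num.min (1 / ln (#|X1|%:R : R))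
    (Num.sqrt (#|X1|%:R / (n12%:R * ln (#|X1|%:R : R))))
  <= testing_radius R X1 X2 X3 n12 n23 n13.
Proof.
move=> X22 X32 n0 X1_ge2; set r : R := #|X1|%:R; set l := ln r => r5 l1 lr.
have [b0 _] : exists b0, b0 \in X2 by apply/card_gt0P; rewrite X22.
have [c0 _] : exists c0, c0 \in X3 by apply/card_gt0P; rewrite X32.
pose D := (Num.truncn l).+1.
have l0 : 0 <= l by lra.
have r0 : 0 < r by lra.
have lD : l <= D%:R by exact: ltW (truncnS_gt l).
have Dl : D%:R <= 2 * l.
  have /andP[h _] := truncn_itv l0; rewrite /D -natr1; lra.
have Dp : 0 < D%:R :> R by rewrite ltr0n.
have np : 0 < n12%:R :> R by rewrite ltr0n.
have [K [t [mu0 [mu1 [t1 dmu0 dmu1 mom gap]]]]] :=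
  @exists_moment_matching_measures R D isT.
have e30 := expR_gt0 (3 : R).
(* the largest [a ^ 2] for which the tail bound applies *)
pose a2 := r * D%:R / (2 * n12%:R * expR 3).
have a20 : 0 <= a2 by rewrite divr_ge0 ?mulr_ge0 // ltW.
pose a := Num.min (2^-1) (Num.sqrt a2).
have a0 : 0 <= a by rewrite le_min invr_ge0 sqrtr_ge0 ler0n.
have ah : a <= 2^-1 by rewrite ge_min lexx.
have aa2 : a ^+ 2 <= a2.
  rewrite -[leRHS](sqr_sqrtr a20) ler_sqr ?nnegrE ?sqrtr_ge0 //.
  by rewrite ge_min lexx orbT.
have asmall : n12%:R * (2 / r * a ^+ 2 * expR 3) <= D%:R.
  apply: (@le_trans _ _ (n12%:R * (2 / r * a2 * expR 3))).
    apply: ler_wpM2l; first exact: ltW.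
    apply: ler_wpM2r; first exact: ltW.
    by apply: ler_wpM2l => //; rewrite divr_ge0 // ltW.
  by rewrite le_eqVlt; apply/orP; left; apply/eqP; rewrite /a2; field; rewrite !gt_eqF.
have mom' j : (j < 2 * D)%N -> \sum_k (mu1 k - mu0 k) * t k ^+ j = 0.
  by move=> jD; apply: mom; rewrite (leq_trans (ltnW jD)) ?leq_addr.
have g0 : 0 < (30 * D%:R)^-1 :> R by rewrite invr_gt0 mulr_gt0.
have /andP[mr3 mr2] := @half_card_bounds R X1 X1_ge2.
have small : (#|X1|./2)%:R * (2 * expR (- (2 * D%:R)))
    + 20 / ((#|X1|./2)%:R * (30 * D%:R)^-1 ^+ 2) <= 2 / 5 :> R.
  have m0 : 0 < (#|X1|./2)%:R :> R by rewrite ltr0n half_gt0.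
  set mm := (#|X1|./2)%:R in m0 mr3 mr2 *; rewrite -/r in mr3 mr2.
  have E : expR (- (2 * D%:R)) <= (r ^+ 2)^-1.
    rewrite expRN lef_pV2 ?posrE ?exprn_gt0 ?expR_gt0 //.
    rewrite -[r in leLHS]lnK ?posrE // -expRM_natr ler_expR -/l; lra.
  have h1 : mm * (2 * expR (- (2 * D%:R))) <= 5^-1.
    apply: (@le_trans _ _ (r / 2 * (2 * (r ^+ 2)^-1))).
      by apply: ler_pM => //; rewrite ?mulr_ge0 ?expR_ge0 ?ler_pM2l.
    have -> : r / 2 * (2 * (r ^+ 2)^-1) = r^-1 by field; rewrite gt_eqF.
    by rewrite lef_pV2 ?posrE.
  have h2 : 20 / (mm * (30 * D%:R)^-1 ^+ 2) <= 5^-1.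
    have -> : 20 / (mm * (30 * D%:R)^-1 ^+ 2) = 20 * 30 ^+ 2 * D%:R ^+ 2 / mm.
      by field; rewrite !gt_eqF.
    rewrite ler_pdivrMr //.
    have : D%:R ^+ 2 <= (2 * l) ^+ 2 by rewrite ler_sqr ?nnegrE ?mulr_ge0 // ltW.
    rewrite exprMn => ?; lra.
  lra.
apply: le_trans (radius_ge_modulus b0 c0 X1_ge2 X22 X32 t1 dmu0 dmu1 mom' a0 ah
  asmall g0 gap n23 n13 small).
have -> : a * (30 * D%:R)^-1 / 72 = a / D%:R / 72 / 30.
  by field; rewrite gt_eqF.
rewrite /rate_constant 2!(mulrAC _ _^-1 (Num.min _ _)).
do 2 (apply: ler_wpM2r; first by rewrite invr_ge0).
set k := expR (-2) / 2.
have k0 : 0 < k by rewrite divr_gt0 ?expR_gt0.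
have k4 : k <= 4^-1.
  have e2 := expR_ge1Dx (2 : R); rewrite /k expRN.
  have : (expR (2 : R))^-1 <= 2^-1 by rewrite lef_pV2 ?posrE ?expR_gt0 //; lra.
  lra.
rewrite ler_pdivlMr // /a le_min; set s := Num.sqrt _; set mn := Num.min _ _.
have mnl : mn <= 1 / l by rewrite ge_min lexx.
have mns : mn <= s by rewrite ge_min lexx orbT.
have mn0 : 0 <= mn by rewrite le_min sqrtr_ge0 divr_ge0.
apply/andP; split.
  apply: (@le_trans _ _ (4^-1 * (1 / l) * (2 * l))).
    have kmn : k * mn <= 4^-1 * (1 / l) by apply: ler_pM; rewrite ?(ltW k0).
    by apply: ler_pM; rewrite ?mulr_ge0 ?(ltW k0) ?(ltW Dp).
  rewrite le_eqVlt; apply/orP; left; apply/eqP; field; rewrite gt_eqF //; lra.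
apply: (@le_trans _ _ (k * s * D%:R)).
  by apply: ler_wpM2r; [exact: ltW | apply: ler_wpM2l => //; exact: ltW].
have s0 : 0 <= s by exact: sqrtr_ge0.
rewrite -ler_sqr ?nnegrE ?sqrtr_ge0 ?mulr_ge0 // ?(ltW k0) // sqr_sqrtr //.
have s2 : s ^+ 2 = r / (n12%:R * l).
  by rewrite sqr_sqrtr // divr_ge0 ?mulr_ge0 // ltW.
rewrite 2!exprMn s2 /a2.
have ke : k ^+ 2 <= (4 * expR 3)^-1.
  rewrite /k exprMn -expRM_natr invfM mulrC exprVn.
  have -> : 2 ^+ 2 = 4 :> R by ring.
  by apply: ler_wpM2l => //; rewrite -expRN ler_expR; lra.
have lp : 0 < l by lra.
set X := r / (n12%:R * l).
have X0 : 0 <= X by apply: divr_ge0; rewrite ?mulr_ge0 ?(ltW np) ?(ltW r0).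
have kX : k ^+ 2 * X <= (4 * expR 3)^-1 * X by exact: ler_wpM2r.
have DD : D%:R ^+ 2 <= D%:R * (2 * l).
  by rewrite expr2; apply: ler_wpM2l => //; exact: ltW.
apply: (@le_trans _ _ ((4 * expR 3)^-1 * X * (D%:R * (2 * l)))).
  by apply: ler_pM => //; apply: mulr_ge0 => //; exact: sqr_ge0.
rewrite /X.
rewrite le_eqVlt; apply/orP; left; apply/eqP; field.
by rewrite !gt_eqF.
Qed.

Lemma radius_ge_parametric (X1 X2 X3 : finType) (n12 n23 n13 : nat) :
  (0 < #|X1|)%N -> #|X2| = 2%N -> #|X3| = 2%N ->
  (0 < n12)%N -> (0 < n23)%N -> (0 < n13)%N ->
  18^-1 * (1 / Num.sqrt ((minn n12 (minn n23 n13))%:R : R))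
  <= testing_radius R X1 X2 X3 n12 n23 n13.
Proof.
move=> X1_gt0 X22 X32 n0 n1 n2.
have [b0 _] : exists b0, b0 \in X2 by apply/card_gt0P; rewrite X22.
have [c0 _] : exists c0, c0 \in X3 by apply/card_gt0P; rewrite X32.
have -> n : 18^-1 * (1 / Num.sqrt n%:R) = 1 / (18 * Num.sqrt n%:R) :> R.
  by rewrite !div1r invfM.
rewrite /minn; case: ifP => _; first exact: (radius_ge_parametric12 b0 c0).
case: ifP => _; first exact: (radius_ge_parametric23 b0 c0).
by rewrite -testing_radius_swap; exact: (radius_ge_parametric12 c0 b0).
Qed.

End Rates.

Theorem theorem8 (R : realType) :
  exists c : R, 0 < c /\
    forall (r : nat) (X1 X2 X3 : finType) (n12 n23 n13 : nat),
      (2 <= r)%N -> #|X1| = r -> #|X2| = 2%N -> #|X3| = 2%N ->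
      (0 < n12)%N -> (0 < n23)%N -> (0 < n13)%N ->
      c * Num.max
            (Num.min (1 / ln (r%:R : R))
               (Num.sqrt (r%:R / ((minn n12 n13)%:R * ln (r%:R : R)))))
            (1 / Num.sqrt ((minn n12 (minn n23 n13))%:R : R))
      <= testing_radius R X1 X2 X3 n12 n23 n13.
Proof.
have big0 : 0 < 20 * 30 ^+ 2 * 60 :> R.
  by apply: mulr_gt0 => //; apply: mulr_gt0 => //; exact: exprn_gt0.
have [r0 r00 Hr0] := sqr_ln_le_eventually big0.
have ln2 : 0 < ln (2 : R) by rewrite ln_gt0 // ltr1n.
pose M := Num.max r0 5.
have M0 : 0 < M by rewrite lt_max r00.
pose C := Num.sqrt (M / ln 2).
have C0 : 0 < C by rewrite sqrtr_gt0 divr_gt0.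
pose c := Num.min (@rate_constant R) (Num.min 18^-1 (18 * C)^-1).
have C18 : 0 < 18 * C by exact: mulr_gt0.
have c0 : 0 < c by rewrite /c !lt_min rate_constant_gt0 !invr_gt0 C18 andbT ltr0n.
have c1 : c <= @rate_constant R by rewrite ge_min lexx.
have c2 : c <= 18^-1 by rewrite !ge_min lexx orbT.
have c3 : c <= (18 * C)^-1 by rewrite !ge_min lexx !orbT.
exists c; split => // r X1 X2 X3 n12 n23 n13 r2 X1r X22 X32 n0 n1 n2.
have par : 18^-1 * (1 / Num.sqrt ((minn n12 (minn n23 n13))%:R : R))
    <= testing_radius R X1 X2 X3 n12 n23 n13.
  by apply: radius_ge_parametric => //; rewrite X1r; exact: ltnW.
set y := 1 / Num.sqrt _ in par *; set x := Num.min _ _.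
have y0 : 0 <= y by rewrite divr_ge0 ?sqrtr_ge0.
have lnr : 0 < ln (r%:R : R) by rewrite ln_gt0 // ltr1n.
have x0 : 0 <= x by rewrite le_min sqrtr_ge0 divr_ge0 // ltW.
case: (leP x y) => _.
  by apply: le_trans par; apply: ler_wpM2r.
case: (lerP M r%:R) => rM.
  apply: (@le_trans _ _ (rate_constant * x)); first exact: ler_wpM2r.
  move: rM; rewrite ge_max => /andP[/Hr0[l1 lr] r5].
  rewrite /x /minn -X1r; case: ifP => _.
    by apply: radius_ge_nonparametric => //; rewrite X1r.
  by rewrite -testing_radius_swap; apply: radius_ge_nonparametric => //; rewrite X1r.
(* for bounded [r] the first rate is dominated by the parametric one *)
apply: le_trans par.
apply: (@le_trans _ _ ((18 * C)^-1 * (C * y))); last first.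
  by rewrite le_eqVlt; apply/orP; left; apply/eqP; field; rewrite gt_eqF.
apply: ler_pM => //; first exact: ltW.
apply: (@le_trans _ _ (Num.sqrt (r%:R / ((minn n12 n13)%:R * ln (r%:R : R))))).
  by rewrite ge_min lexx orbT.
set N := minn n12 (minn n23 n13) in y y0 *; set N' := minn n12 n13.
have N0 : (0 < N)%N by rewrite !leq_min n0 n1 n2.
have NN' : (N <= N')%N.
  by rewrite leq_min geq_minl (leq_trans (geq_minr _ _) (geq_minr _ _)).
have Np : 0 < N%:R :> R by rewrite ltr0n.
rewrite /y div1r -sqrtrV ?ler0n // -sqrtrM ?divr_ge0 ?(ltW M0) ?(ltW ln2) //.
rewrite ler_sqrt ?mulr_ge0 ?invr_ge0 ?divr_ge0 ?(ltW M0) ?(ltW ln2) ?ler0n //.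
rewrite -mulrA -invfM; apply: ler_pM; rewrite ?invr_ge0 ?mulr_ge0 ?ler0n ?(ltW lnr) ?(ltW rM) //.
rewrite lef_pV2 ?posrE ?mulr_gt0 //; last by rewrite ltr0n (leq_trans N0).
rewrite mulrC; apply: ler_pM; rewrite ?ler0n ?(ltW ln2) ?ler_nat //.
by rewrite ler_ln ?posrE ?ltr0n ?ler_nat // (leq_trans _ r2).
Qed.
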